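(* Let $G\rightrightarrows X$ be a proper locally compact groupoid, $\boldsymbol A$ a Banach algebra, and $\sigma$ an $\boldsymbol A$-valued multiplier for $G$ satisfying $|\sigma(g,h)^{-1}|=1/|\sigma(g,h)|$. Let $x\in X$ and let $S:G(x)\to\mathrm{GL}_{\boldsymbol A}(\boldsymbol E)$ be a uniformly continuous $\sigma$-representation of the isotropy group $G(x)$ on a Banach $\boldsymbol A$-module $\boldsymbol E$. Then there exist an open neighborhood $V$ of $x$ in $X$ and a uniformly continuous $\sigma$-representation $R:G|V\to\mathrm{GL}_{\boldsymbol A}(\boldsymbol E)$ of $G|V\rightrightarrows V$ with $R(k)=S(k)$ for all $k\in G(x)$.
   Context: A locally compact groupoid is a topological groupoid $G\rightrightarrows X$ (source $s$, target $t$, units $1x$, composable pairs $G\times_{s,t}G=\{(g,h):sg=th\}$) with locally compact Hausdorff arrow space and a continuous left Haar system $\{\mu^x\}$ (Radon measures with support $t^{-1}(x)$, left invariant, $x\mapsto\int\varphi\,d\mu^x$ continuous for $\varphi\in C_c(G)$). A cutoff function is a continuous $c:X\to\mathbb R_{\ge0}$ with $\mathrm{supp}(c\circ s)\cap t^{-1}(C)$ compact for compact $C\subset X$ and every orbit meeting $\{c>0\}$; $G$ is proper if one exists. $G(x)=s^{-1}(x)\cap t^{-1}(x)$; $G|V=s^{-1}(V)\cap t^{-1}(V)$. Banach algebras are unital with $|ab|\le|a||b|$, $|1|=1$. An $\boldsymbol A$-valued multiplier is a continuous map $\sigma:G\times_{s,t}G\to\boldsymbol A^\times$ with values in the center of $\boldsymbol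 A$, $\sigma(g,h)=1$ if $g$ or $h$ is a unit, and $\sigma(g,h)\sigma(gh,k)=\sigma(h,k)\sigma(g,hk)$. A Banach $\boldsymbol A$-module $\boldsymbol E$ satisfies $|ae|\le|a||e|$, $1e=e$; $\mathrm{GL}_{\boldsymbol A}(\boldsymbol E)$ is the group of invertible bounded $\boldsymbol A$-linear operators. For a subgroupoid $H$ of $G$ (such as $G(x)$ or $G|V$), a uniformly continuous $\sigma$-representation of $H$ on $\boldsymbol E$ is a map $R:H\to\mathrm{GL}_{\boldsymbol A}(\boldsymbol E)$ continuous for the operator-norm topology with $R(1y)=\mathrm{id}$ for units and $\sigma(g,h)R(gh)=R(g)R(h)$ for composable $(g,h)$ in $H$. *)

(* Defs.v *)
From HB Require Import structures.
From mathcomp Require Import all_boot all_order all_algebra.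
From mathcomp Require Import all_classical all_reals all_analysis.
Set Implicit Arguments. Unset Strict Implicit. Unset Printing Implicit Defensive.
Import Order.TTheory GRing.Theory Num.Theory.
Import numFieldNormedType.Exports.
Local Open Scope classical_set_scope.
Local Open Scope ring_scope.

(** * Banach algebras (over a real field R; complex ones are in particular real ones) *)

Definition banach_algebra (R : numFieldType) (A : completeNormedModType R)
  (amul : A -> A -> A) (aone : A) : Prop :=
  [/\ (forall a b c, amul (amul a b) c = amul a (amul b c)),
      (forall a, amul aone a = a /\ amul a aone = a),
      (forall a b c, amul a (b + c) = amul a b + amul a c /\
                     amul (a + b) c = amul a c + amul b c),
      (forall (r : R) a b, amul (r *: a) b = r *: amul a b /\ amul a (r *: b) = r *: amul a b) &
      ((forall a b, `|amul a b| <= `|a| * `|b|) /\ `|aone| = 1)].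

Definition invertible_elt (R : numFieldType) (A : completeNormedModType R)
  (amul : A -> A -> A) (aone : A) (a : A) : Prop :=
  exists b : A, amul a b = aone /\ amul b a = aone.

Definition central (R : numFieldType) (A : completeNormedModType R)
  (amul : A -> A -> A) (a : A) : Prop :=
  forall b : A, amul a b = amul b a.

Definition banach_module (R : numFieldType) (A : completeNormedModType R)
  (amul : A -> A -> A) (aone : A)
  (E : completeNormedModType R) (act : A -> E -> E) : Prop :=
  [/\ (forall a e f, act a (e + f) = act a e + act a f),
      (forall a b e, act (a + b) e = act a e + act b e),
      (forall (r : R) a e, act (r *: a) e = r *: act a e /\ act a (r *: e) = r *: act a e),
      (forall a b e, act (amul a b) e = act a (act b e)) &
      ((forall e, act aone e = e) /\
       (forall a e, `|act a e| <= `|a| * `|e|))].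

Definition bounded_A_linear (R : numFieldType) (A : completeNormedModType R)
  (E : completeNormedModType R) (act : A -> E -> E) (T : E -> E) : Prop :=
  [/\ (forall e f, T (e + f) = T e + T f),
      (forall (r : R) e, T (r *: e) = r *: T e),
      (forall a e, T (act a e) = act a (T e)) &
      (exists C : R, forall e, `|T e| <= C * `|e|)].

Definition GL_A (R : numFieldType) (A : completeNormedModType R)
  (E : completeNormedModType R) (act : A -> E -> E) (T : E -> E) : Prop :=
  bounded_A_linear act T /\
  exists T' : E -> E, bounded_A_linear act T' /\ cancel T T' /\ cancel T' T.

Record groupoid (X G : Type) := Groupoid {
  src : G -> X;  tgt : G -> X;  unit : X -> G;
  gmul : G -> G -> G;  (* meaningful on composable pairs only *)
  ginv : G -> G }.

Definition composable (X G : Type) (Gd : groupoid X G) : set (G * G) :=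
  [set p | src Gd p.1 = tgt Gd p.2].

Definition groupoid_axioms (X G : Type) (Gd : groupoid X G) : Prop :=
  let s := src Gd in let t := tgt Gd in let u := unit Gd in
  let m := gmul Gd in let i := ginv Gd in
  [/\ (forall x, s (u x) = x /\ t (u x) = x),
      (forall g h, s g = t h -> s (m g h) = s h /\ t (m g h) = t g),
      (forall g h k, s g = t h -> s h = t k -> m (m g h) k = m g (m h k)),
      (forall g, m (u (t g)) g = g /\ m g (u (s g)) = g) &
      (forall g, [/\ s (i g) = t g, t (i g) = s g,
                     m g (i g) = u (t g) & m (i g) g = u (s g)])].

Definition Borel (G : ptopologicalType) := g_sigma_algebraType (@open G).

Definition Cc (R : realType) (G : ptopologicalType) (phi : G -> R) : Prop :=
  continuous phi /\ compact (closure [set g | phi g != 0]).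

Definition radon (R : realType) (G : ptopologicalType)
  (mu : {measure set (Borel G) -> \bar R}) : Prop :=
  [/\ (forall K : set G, compact K -> (mu K < +oo)%E),
      (forall B : set (Borel G), measurable B ->
          mu B = ereal_inf [set mu U | U in [set U : set G | open U /\ B `<=` U]]) &
      (forall U : set G, open U ->
          mu U = ereal_sup [set mu K | K in [set K : set G | compact K /\ K `<=` U]])].

Definition msupport (R : realType) (G : ptopologicalType)
  (mu : {measure set (Borel G) -> \bar R}) : set G :=
  [set g | forall U : set G, open U -> U g -> (0 < mu U)%E].

Definition haar_system (R : realType) (X : topologicalType) (G : ptopologicalType)
  (Gd : groupoid X G) (mu : X -> {measure set (Borel G) -> \bar R}) : Prop :=
  [/\ (forall x, radon (mu x)),
      (forall x, msupport (mu x) = tgt Gd @^-1` [set x]),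
      (forall (g : G) (phi : G -> R), Cc phi ->
          (\int[mu (src Gd g)]_(h in tgt Gd @^-1` [set src Gd g]) (phi (gmul Gd g h))%:E
           = \int[mu (tgt Gd g)]_(h in tgt Gd @^-1` [set tgt Gd g]) (phi h)%:E)%E) &
      (forall phi : G -> R, Cc phi ->
          continuous (fun x : X => fine (\int[mu x]_(h in [set: Borel G]) (phi h)%:E)%E))].

Definition locally_compact_groupoid (R : realType) (X : topologicalType)
  (G : ptopologicalType) (Gd : groupoid X G)
  (mu : X -> {measure set (Borel G) -> \bar R}) : Prop :=
  [/\ groupoid_axioms Gd,
      [/\ continuous (src Gd), continuous (tgt Gd), continuous (unit Gd),
          continuous (ginv Gd) &
          {within composable Gd, continuous (fun p : G * G => gmul Gd p.1 p.2)}],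
      hausdorff_space G /\ locally_compact [set: G] &
      haar_system Gd mu].

Definition cutoff (R : realType) (X : topologicalType) (G : ptopologicalType)
  (Gd : groupoid X G) (c : X -> R) : Prop :=
  [/\ continuous c, (forall x, 0 <= c x),
      (forall C : set X, compact C ->
         compact (closure [set g : G | c (src Gd g) != 0] `&` tgt Gd @^-1` C)) &
      (forall x : X, exists g : G, src Gd g = x /\ 0 < c (tgt Gd g))].

Definition proper_groupoid (R : realType) (X : topologicalType) (G : ptopologicalType)
  (Gd : groupoid X G) : Prop :=
  exists c : X -> R, cutoff Gd c.

Definition multiplier (R : realType) (X : topologicalType) (G : ptopologicalType)
  (Gd : groupoid X G) (A : completeNormedModType R)
  (amul : A -> A -> A) (aone : A) (sigma : G -> G -> A) : Prop :=
  [/\ {within composable Gd, continuous (fun p : G * G => sigma p.1 p.2)},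
      (forall g h, src Gd g = tgt Gd h -> invertible_elt amul aone (sigma g h) /\ central amul (sigma g h)),
      (forall g h, src Gd g = tgt Gd h ->
         (exists y, g = unit Gd y) \/ (exists y, h = unit Gd y) -> sigma g h = aone) &
      (forall g h k, src Gd g = tgt Gd h -> src Gd h = tgt Gd k ->
         amul (sigma g h) (sigma (gmul Gd g h) k) = amul (sigma h k) (sigma g (gmul Gd h k)))].

Definition isotropy (X G : Type) (Gd : groupoid X G) (x : X) : set G :=
  [set g | src Gd g = x /\ tgt Gd g = x].

Definition restriction (X G : Type) (Gd : groupoid X G) (V : set X) : set G :=
  [set g | V (src Gd g) /\ V (tgt Gd g)].

Definition unif_cont_sigma_rep (R : realType) (X : topologicalType) (G : ptopologicalType)
  (Gd : groupoid X G) (A : completeNormedModType R) (sigma : G -> G -> A)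
  (E : completeNormedModType R) (act : A -> E -> E)
  (H : set G) (Rep : G -> E -> E) : Prop :=
  [/\ (forall h, H h -> GL_A act (Rep h)),
      (* continuity for the operator-norm topology, on H with the subspace topology *)
      (forall h, H h -> forall eps : R, 0 < eps ->
         \forall k \near h, H k -> forall e : E, `|Rep k e - Rep h e| <= eps * `|e|),
      (forall y : X, H (unit Gd y) -> Rep (unit Gd y) = id) &
      (forall g h, H g -> H h -> src Gd g = tgt Gd h ->
         forall e : E, act (sigma g h) (Rep (gmul Gd g h) e) = Rep g (Rep h e))].

(* Main.v *)
Require Import Defs.
From HB Require Import structures.
From mathcomp Require Import all_boot all_order all_algebra.
From mathcomp Require Import all_classical all_reals all_analysis.
From mathcomp Require Import measurable_realfun.
From mathcomp Require Import ring lra.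
Set Implicit Arguments. Unset Strict Implicit. Unset Printing Implicit Defensive.
Import Order.TTheory GRing.Theory Num.Theory.
Import numFieldNormedType.Exports.
Local Open Scope classical_set_scope.
Local Open Scope ring_scope.

(** Averaging over the Haar system turns a near representation T of G|V, with
    V = {w != 0}, into one whose defect is quadratically smaller:
      T^(g) = (1/N) \int w(s h) sigma(g,h) T(gh) T(h)^-1 dmu^{s g}(h).
    By the cocycle identity and left invariance, the new defect is the covariance
    of two integrands lying within delta*M of constants.  Iterating from a
    continuous approximate extension of S near the compact group G(x), on a
    neighbourhood so small that its defect is tiny, gives a genuine
    representation T of G|V close to S on G(x).  The invariant mean of
    S(k) T(k)^-1 over G(x) is then an invertible intertwiner P, and P T P^-1
    extends S.  The invariant mean on G(x) is the limit, along an ultrafilter, of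
    the averages against mu^x weighted by bump functions w(s h) concentrating at
    x: such weights are invariant under left translation by G(x). *)

(** * The Hahn-Banach theorem *)

(** Averaging need not preserve the values on G(x), even for a family that extends S exactly: for g
    in G(x) the integral runs over all arrows h with target x and source in V, and T need not be
    multiplicative there. This forces the final conjugation. The domain does not shrink during the
    iteration because V is exactly the set where the weight is nonzero: off G|V, where T is
    uncontrolled, the integrand vanishes, and its continuity at the boundary comes from a uniform
    operator bound times w tending to 0. With inverses bounded by 2M, averaging turns a defect d
    into 16 M^2 d^2, so [32 * M ^+ 2 * delta <= 1] makes every step at least halve the defect. The
    displacements then sum geometrically and keep all inverses bounded by 2M. Multiplication is
    continuous on composable pairs only, so a translated integrand is continuous on a fibre and not
    on G. Integrals are therefore built from [Cc] approximants but compared in L1. *)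

Section HahnBanach.
Variables (R : realType) (E : lmodType R).
Implicit Types (p q : E -> R) (v x y : E).

Definition sublinear q :=
  (forall x y, q (x + y) <= q x + q y) /\
  (forall r x, 0 <= r -> q (r *: x) <= r * q x).

Lemma sublinear0 q : sublinear q -> q 0 = 0.
Proof.
move=> [qD qZ]; have := qD 0 0; have := qZ 0 0 (lexx _).
by rewrite scale0r addr0 mul0r => ? ?; lra.
Qed.

Lemma sublinearN q x : sublinear q -> - q (- x) <= q x.
Proof.
by move=> sq; have := sublinear0 sq; have := sq.1 x (- x); rewrite subrr; lra.
Qed.

Lemma sublinear_pZ q r x : sublinear q -> 0 <= r -> q (r *: x) = r * q x.
Proof.
move=> sq; rewrite le_eqVlt => /predU1P[<-|r0].
  by rewrite scale0r mul0r sublinear0.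
apply/eqP; rewrite eq_le sq.2 ?(ltW r0)//=.
have := sq.2 r^-1 (r *: x); rewrite scalerA mulVf ?gt_eqF// scale1r.
rewrite invr_ge0 (ltW r0) => /(_ isT).
by rewrite ler_pdivlMl.
Qed.

(** The greatest sublinear functional below [q] whose value at [- v] is at most [- q v]: any such p
    satisfies p x <= p (x + t v) + t p (- v). It forces oddness in the direction [v]. *)
Let tilt q v x := inf [set q (x + t *: v) - t * q v | t in [set t | 0 <= t]].

Let tilt_le q v x t : sublinear q -> 0 <= t ->
  tilt q v x <= q (x + t *: v) - t * q v.
Proof.
move=> sq t0; apply: ge_inf; last by exists t.
exists (- q (- x)) => _ [u /= u0 <-].
have := sq.1 (x + u *: v) (- x); rewrite addrAC subrr add0r sublinear_pZ//.
lra.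
Qed.

Let tilt_ge q v x c : (forall t, 0 <= t -> c <= q (x + t *: v) - t * q v) ->
  c <= tilt q v x.
Proof.
move=> h; apply: lb_le_inf; first by exists (q (x + 0 *: v) - 0 * q v); exists 0 => /=.
by move=> _ [t t0 <-]; exact: h.
Qed.

Let tilt_sublinear q v : sublinear q -> sublinear (tilt q v).
Proof.
move=> sq; split=> [x y|r x].
  rewrite -lerBlDr; apply: (tilt_ge) => t t0; rewrite lerBlDr -lerBlDl.
  apply: (tilt_ge) => u u0; rewrite lerBlDl.
  apply: (le_trans (tilt_le _ (x + y) sq (addr_ge0 u0 t0))).
  have := sq.1 (y + u *: v) (x + t *: v).
  rewrite addrACA -scalerDl (addrC y); lra.
rewrite le_eqVlt => /predU1P[<-|r0].
  rewrite scale0r mul0r; apply: (le_trans (tilt_le _ 0 sq (lexx 0))).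
  by rewrite scale0r addr0 mul0r subr0 sublinear0.
rewrite -ler_pdivrMl//; apply: (tilt_ge) => t t0; rewrite ler_pdivrMl//.
have rt0 : 0 <= r * t by rewrite mulr_ge0// ltW.
apply: (le_trans (tilt_le _ _ sq rt0)).
by rewrite -scalerA -scalerDr sublinear_pZ ?(ltW r0)// mulrBr mulrA.
Qed.

Let tilt_dom q v x : sublinear q -> tilt q v x <= q x.
Proof.
move=> sq; apply: (le_trans (tilt_le _ _ sq (lexx 0))).
by rewrite scale0r addr0 mul0r subr0.
Qed.

Let tiltN q v : sublinear q -> tilt q v (- v) <= - q v.
Proof.
move=> sq; apply: (le_trans (tilt_le _ _ sq ler01)).
by rewrite scale1r addNr mul1r sublinear0// sub0r.
Qed.

(* Tilting a minimal sublinear functional leaves it unchanged, which makes it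
   odd, hence linear. *)
Lemma sublinear_minimal p : sublinear p ->
  exists f : E -> R, [/\ forall x y, f (x + y) = f x + f y,
    forall r x, f (r *: x) = r * f x & forall x, f x <= p x].
Proof.
move=> sp.
pose T := {q : E -> R | sublinear q /\ forall x, q x <= p x}.
(* The order is reversed: a maximal element for [le] is a pointwise minimal functional. *)
pose le (s t : {classic T}) := `[< forall x, sval t x <= sval s x >].
have [//| | |[q [sq qp]] qmin] := @ZL_preorder {classic T} (exist _ p (conj sp (fun=> lexx _))) le.
- by move=> s; apply/asboolP.
- move=> s t u /asboolP ts /asboolP tu; apply/asboolP => z.
  exact: le_trans (tu z) (ts z).
- move=> A Atot.
  have [[s0 As0]|A0] := pselect (A !=set0); last first.
    by exists (exist _ p (conj sp (fun=> lexx _))) => s As; exfalso; apply: A0; exists s.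
  pose m x := inf [set sval s x | s in A].
  have m_le s x : A s -> m x <= sval s x.
    move=> As; apply: ge_inf; last by exists s.
    exists (- p (- x)) => _ [u Au <-].
    have [su up] := svalP u; have := up (- x); have := sublinearN x su; lra.
  have m_ge x c : (forall s, A s -> c <= sval s x) -> c <= m x.
    move=> h; apply: lb_le_inf; first by exists (sval s0 x), s0.
    by move=> _ [s As <-]; exact: h.

  have sm : sublinear m.
    split=> [x y|r x r0].
      rewrite -lerBlDr; apply: (m_ge) => s As; rewrite lerBlDr -lerBlDl.
      apply: (m_ge) => u Au; rewrite lerBlDl.
      have [ss _] := svalP s; have [su _] := svalP u.
      (* Members of the chain are comparable, so the smaller of the two serves for both summands. *)
      have [/asboolP su'|/asboolP us] := Atot _ _ As Au.
        apply: (le_trans (m_le u _ Au)).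
        have := su.1 x y; have := su' x; lra.
      apply: (le_trans (m_le s _ As)).
      have := ss.1 x y; have := us y; lra.
    move: r0; rewrite le_eqVlt => /predU1P[<-|r0].
      rewrite scale0r mul0r; apply: le_trans (m_le _ _ As0) _.
      by rewrite sublinear0//; have [] := svalP s0.
    rewrite -ler_pdivrMl//; apply: (m_ge) => s As; rewrite ler_pdivrMl//.
    apply: (le_trans (m_le s _ As)); have [ss _] := svalP s.
    by rewrite sublinear_pZ// ltW.
  have mp x : m x <= p x.
    by apply: le_trans (m_le _ _ As0) _; have [_] := svalP s0; exact.
  by exists (exist _ m (conj sm mp)) => s As; apply/asboolP => x; exact: m_le.
have qle v x : q x <= tilt q v x.
  have tp y : tilt q v y <= p y by exact: le_trans (tilt_dom _ _ sq) (qp y).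
  have := qmin (exist _ (tilt q v) (conj (tilt_sublinear v sq) tp)).
  move=> /(_ _)/asboolP; apply; apply/asboolP => y /=; exact: tilt_dom.
have qN x : q (- x) = - q x.
  apply/eqP; rewrite eq_le (le_trans (qle x _) (tiltN _ sq))/=.
  by have := sublinearN x sq; lra.
have qD x y : q (x + y) = q x + q y.
  apply/eqP; rewrite eq_le sq.1 /=.
  by have := sq.1 (- x) (- y); rewrite -opprD !qN; lra.
exists q; split => // r x.
have [r0|r0] := leP 0 r; first by rewrite sublinear_pZ.
rewrite -[r]opprK scaleNr qN sublinear_pZ ?oppr_ge0 ?ltW//; lra.
Qed.

(** A linear functional below the tilt, rather than below [p] itself, satisfies f (- v) <= - p v,
    which is the missing inequality at [v]; no extension from a subspace occurs. *)
Lemma hahn_banach p v : sublinear p ->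
  exists f : E -> R, [/\ forall x y, f (x + y) = f x + f y,
    forall r x, f (r *: x) = r * f x, forall x, f x <= p x & f v = p v].
Proof.
move=> sp; have [f [fD fZ ft]] := sublinear_minimal (tilt_sublinear v sp).
have fp x : f x <= p x by exact: le_trans (ft x) (tilt_dom _ _ sp).
exists f; split => //; apply/eqP; rewrite eq_le fp/=.
have := le_trans (ft (- v)) (tiltN v sp).
by rewrite -scaleN1r fZ mulN1r; lra.
Qed.

End HahnBanach.

Lemma norming_functional (R : realType) (E : normedModType R) (v : E) :
  exists f : E -> R, [/\ forall x y, f (x + y) = f x + f y,
    forall r x, f (r *: x) = r * f x, forall x, f x <= `|x| & f v = `|v|].
Proof.
apply: hahn_banach; split=> [x y|r x r0]; first exact: ler_normD.
by rewrite normrZ ger0_norm.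
Qed.

(** * Vector-valued integration *)

Section AbstractIntegral.
Variables (R : realType) (T : Type) (E : completeNormedModType R).
Implicit Types (D : set (T -> R)) (I : (T -> R) -> R) (Z : set T).
Implicit Types (f : T -> E) (phi chi w : T -> R) (b v : E).

(** Monotonicity compares functions on [Z] only, so values off [Z] never matter. The same theory
    then serves the Haar measures on target fibres and the mean on the isotropy group. *)
Definition positive_functional Z D I :=
  [/\ D (fun=> 0),
      forall r phi chi, D phi -> D chi -> D (fun x => r * phi x + chi x),
      forall r phi chi, D phi -> D chi ->
        I (fun x => r * phi x + chi x) = r * I phi + I chi &
      forall phi chi, D phi -> D chi ->
        (forall x, Z x -> phi x <= chi x) -> I phi <= I chi].

(** The value is carried along with the finite sum, so it need not be shown independent of the
    presentation before it can be used. *)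
Inductive elementary D I : (T -> E) -> E -> Prop :=
| elementary0 : elementary D I (fun=> 0) 0
| elementaryS phi b f v : D phi -> elementary D I f v ->
    elementary D I (fun x => phi x *: b + f x) (I phi *: b + v).

(* Vector-valued integration against a positive functional: the closure of the
   elementary pairs for its L^1 distance.  The norming functionals of Hahn-Banach
   reduce all estimates to scalar integrals. *)
Definition is_integral Z D I f b := forall eps : R, 0 < eps ->
  exists f0 v chi, [/\ elementary D I f0 v, D chi,
    forall x, Z x -> `|f x - f0 x| <= chi x, I chi <= eps & `|b - v| <= eps].

Section Theory.
Variables (Z : set T) (D : set (T -> R)) (I : (T -> R) -> R).
Hypothesis DI : positive_functional Z D I.

Lemma pf0 : I (fun=> 0) = 0.
Proof.
have [D0 _ Il _] := DI; have := Il 1 _ _ D0 D0.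
by under eq_fun do rewrite mulr0 addr0; lra.
Qed.

Lemma pfZ r phi : D phi -> D (fun x => r * phi x) /\ I (fun x => r * phi x) = r * I phi.
Proof.
have [D0 Dl Il _] := DI => Dphi; have := Dl r _ _ Dphi D0.
have := Il r _ _ Dphi D0; rewrite pf0 addr0.
by under eq_fun do rewrite addr0.
Qed.

Lemma pfD phi chi : D phi -> D chi ->
  D (fun x => phi x + chi x) /\ I (fun x => phi x + chi x) = I phi + I chi.
Proof.
have [D0 Dl Il _] := DI => Dphi Dchi; have := Dl 1 _ _ Dphi Dchi.
have := Il 1 _ _ Dphi Dchi; rewrite mul1r.
by under eq_fun do rewrite mul1r.
Qed.

Lemma pf_le phi chi : D phi -> D chi -> (forall x, Z x -> phi x <= chi x) -> I phi <= I chi.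
Proof. by case: DI => _ _ _; exact. Qed.

Lemma elementary_comp f v (l : E -> R) : (forall x y, l (x + y) = l x + l y) ->
  (forall r x, l (r *: x) = r * l x) -> elementary D I f v ->
  D (l \o f) /\ I (l \o f) = l v.
Proof.
have [D0 Dl Il _] := DI; move=> lD lZ; elim=> [|phi b g u Dphi _ [Dg Ig]].
  have l0 : l 0 = 0 by rewrite -(scale0r 0) lZ mul0r.
  rewrite (_ : l \o _ = fun=> 0); last by apply/funext => x /=.
  by rewrite pf0.
rewrite (_ : l \o _ = fun x => l b * phi x + (l \o g) x); last first.
  by apply/funext => x /=; rewrite lD lZ mulrC.
by rewrite Il// Ig lD lZ mulrC; split => //; exact: Dl.
Qed.

Lemma elementary_norm f v w : elementary D I f v -> D w ->
  (forall x, Z x -> `|f x| <= w x) -> `|v| <= I w.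
Proof.
move=> fv Dw fw; have [l [lD lZ ln <-]] := norming_functional v.
have [Dlf <-] := elementary_comp lD lZ fv.
by apply: pf_le => // x Zx; exact: le_trans (ln _) (fw _ Zx).
Qed.

Lemma elementaryD f v g u : elementary D I f v -> elementary D I g u ->
  elementary D I (fun x => f x + g x) (v + u).
Proof.
move=> + gu; elim=> [|phi b f' v' Dphi _ IH].
  by rewrite add0r; under eq_fun do rewrite add0r.
rewrite -addrA; under eq_fun do rewrite -addrA.
exact: elementaryS.
Qed.

Lemma elementary_lin f v (L : E -> E) : (forall x y, L (x + y) = L x + L y) ->
  (forall r x, L (r *: x) = r *: L x) -> elementary D I f v ->
  elementary D I (L \o f) (L v).
Proof.
move=> LD LZ; elim=> [|phi b g u Dphi _ IH].
  have L0 : L 0 = 0 by have := LZ 0 0; rewrite !scale0r.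
  rewrite L0 (_ : L \o _ = fun=> 0); first exact: elementary0.
  by apply/funext => x /=.
rewrite LD LZ (_ : L \o _ = fun x => phi x *: L b + (L \o g) x).
  exact: elementaryS.
by apply/funext => x /=; rewrite LD LZ.
Qed.

Lemma elementaryB f v g u : elementary D I f v -> elementary D I g u ->
  elementary D I (fun x => f x - g x) (v - u).
Proof.
move=> fv gu; apply: elementaryD => //.
by apply: (@elementary_lin _ _ -%R) => // [x y|r x]; rewrite ?opprD ?scalerN.
Qed.

Lemma elementary_sum (J : Type) (s : seq J) (phi : J -> T -> R) (b : J -> E) :
  (forall j, D (phi j)) ->
  elementary D I (fun x => \sum_(j <- s) phi j x *: b j) (\sum_(j <- s) I (phi j) *: b j).
Proof.
move=> Dphi; elim: s => [|j s IH].
  by rewrite big_nil; under eq_fun do rewrite big_nil; exact: elementary0.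
by rewrite big_cons; under eq_fun do rewrite big_cons; exact: elementaryS.
Qed.

Lemma is_integral_norm f b w : is_integral Z D I f b -> D w ->
  (forall x, Z x -> `|f x| <= w x) -> `|b| <= I w.
Proof.
move=> fb Dw fw; apply/ler_addgt0Pr => e e0.
have e20 : 0 < e / 2 by lra.
have [f0 [v [chi [fv Dchi f0chi Ichi bv]]]] := fb _ e20.
have [Dwc Iwc] := pfD Dw Dchi.
have : `|v| <= I (fun x => w x + chi x).
  apply: (elementary_norm fv Dwc) => x Zx.
  rewrite -[f0 x](subKr (f x)); apply: le_trans (ler_normB _ _) _.
  by rewrite lerD ?fw ?f0chi.
have := ler_normD (b - v) v; rewrite subrK Iwc.
lra.
Qed.

Lemma is_integralD f b g c : is_integral Z D I f b -> is_integral Z D I g c ->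
  is_integral Z D I (fun x => f x + g x) (b + c).
Proof.
move=> fb gc e e0; have e20 : 0 < e / 2 by lra.
have [f0 [v [chi [fv Dchi f0chi Ichi bv]]]] := fb _ e20.
have [g0 [u [psi [gu Dpsi g0psi Ipsi cu]]]] := gc _ e20.
have [Dwc Iwc] := pfD Dchi Dpsi.
exists (fun x => f0 x + g0 x), (v + u), (fun x => chi x + psi x); split => //.
- exact: elementaryD.
- move=> x Zx; rewrite opprD addrACA; apply: le_trans (ler_normD _ _) _.
  by rewrite lerD ?f0chi ?g0psi.
- by rewrite Iwc; lra.
- rewrite opprD addrACA; apply: le_trans (ler_normD _ _) _; lra.
Qed.

Lemma is_integral_lin f b (L : E -> E) c : (forall x y, L (x + y) = L x + L y) ->
  (forall r x, L (r *: x) = r *: L x) -> (forall x, `|L x| <= c * `|x|) ->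
  is_integral Z D I f b -> is_integral Z D I (L \o f) (L b).
Proof.
move=> LD LZ Lc fb e e0.
have LB x y : L (x - y) = L x - L y by rewrite LD -scaleN1r LZ scaleN1r.
pose c1 := `|c| + 1; have c10 : 0 < c1 by rewrite /c1 ltr_pwDr.
have Lc1 x : `|L x| <= c1 * `|x|.
  apply: le_trans (Lc x) _; rewrite ler_wpM2r//.
  by apply: le_trans (ler_norm c) _; rewrite /c1 lerDl.
have ec0 : 0 < e / c1 by rewrite divr_gt0.
have [f0 [v [chi [fv Dchi f0chi Ichi bv]]]] := fb _ ec0.
have [Dc Ic] := pfZ c1 Dchi.
exists (L \o f0), (L v), (fun x => c1 * chi x); split => //.
- exact: elementary_lin.
- move=> x Zx /=; rewrite -LB; apply: le_trans (Lc1 _) _.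
  by rewrite ler_wpM2l ?f0chi// ltW.
- by rewrite Ic mulrC -ler_pdivlMr.
- by rewrite -LB; apply: le_trans (Lc1 _) _; rewrite mulrC -ler_pdivlMr.
Qed.

Lemma is_integralB f b g c : is_integral Z D I f b -> is_integral Z D I g c ->
  is_integral Z D I (fun x => f x - g x) (b - c).
Proof.
move=> fb gc; apply: is_integralD => //.
apply: (@is_integral_lin _ _ -%R 1) => // [x y|r x|x]; rewrite ?opprD ?scalerN//.
by rewrite normrN mul1r.
Qed.

Lemma is_integral_unique f b c : is_integral Z D I f b -> is_integral Z D I f c -> b = c.
Proof.
move=> fb fc; apply/eqP; rewrite -subr_eq0 -normr_eq0 eq_le normr_ge0 andbT.
have [D0 _ _ _] := DI; rewrite -pf0.
by apply: (is_integral_norm (is_integralB fb fc) D0) => x _; rewrite subrr normr0.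
Qed.

Lemma is_integral_elementary f v : elementary D I f v -> is_integral Z D I f v.
Proof.
have [D0 _ _ _] := DI => fv e e0; exists f, v, (fun=> 0); split => //.
- by move=> x _; rewrite subrr normr0.
- by rewrite pf0 ltW.
- by rewrite subrr normr0 ltW.
Qed.

Lemma is_integral_scale phi b : D phi -> is_integral Z D I (fun x => phi x *: b) (I phi *: b).
Proof.
move=> Dphi; apply: is_integral_elementary.
have := elementaryS b Dphi (elementary0 D I); rewrite addr0.
by under eq_fun do rewrite addr0.
Qed.

(** Completeness of [E]: the values of two approximants differ by at most the sum of their L^1
    errors, so errors 1/(n+1) give a Cauchy sequence. *)
Lemma is_integral_exists f :
  (forall eps : R, 0 < eps -> exists f0 v chi, [/\ elementary D I f0 v, D chi,
    forall x, Z x -> `|f x - f0 x| <= chi x & I chi <= eps]) ->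
  exists b, is_integral Z D I f b.
Proof.
move=> H.
pose e_ n : R := n.+1%:R^-1.
have e_gt0 n : 0 < e_ n by rewrite /e_ invr_gt0.
have {}H n : exists p : (T -> E) * E * (T -> R), [/\ elementary D I p.1.1 p.1.2, D p.2,
    forall x, Z x -> `|f x - p.1.1 x| <= p.2 x & I p.2 <= e_ n].
  by have [f0 [v [chi ?]]] := H _ (e_gt0 n); exists (f0, v, chi).
have [F HF] := choice H.
pose v_ n := (F n).1.2.
have v_close n m : `|v_ n - v_ m| <= e_ n + e_ m.
  have [fn Dn hn In] := HF n; have [fm Dm hm Im] := HF m.
  have [Ds Is] := pfD Dn Dm.
  apply: le_trans (elementary_norm (elementaryB fn fm) Ds _) _; last by rewrite Is lerD.
  move=> x Zx; rewrite -(subrK (f x) ((F n).1.1 x)) -addrA.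
  by apply: le_trans (ler_normD _ _) _; rewrite distrC lerD ?hn ?hm.
have e_small e : 0 < e -> \forall n \near \oo, e_ n < e.
  by move=> e0; exact: (near_infty_natSinv_lt (PosNum e0)).
have cv : cvgn v_.
  apply/cauchy_cvgP/cauchy_exP => e e0.
  have e20 : 0 < e / 2 by lra.
  have [N eN] := filter_ex (e_small _ e20).
  exists (v_ N); suff : \forall n \near \oo, ball (v_ N) e (v_ n) by [].
  near=> n; rewrite -ball_normE /=; apply: le_lt_trans (v_close _ _) _.
  have : e_ n < e / 2 by near: n; exact: e_small.
  lra.
exists (limn v_) => e e0.
have e20 : 0 < e / 2 by lra.
have [n [ne1 ne2]] : exists n, e_ n < e / 2 /\ `|limn v_ - v_ n| < e / 2.
  have /cvgrPdist_lt/(_ _ e20) h1 : v_ @ \oo --> limn v_ by [].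
  have h2 := e_small _ e20.
  by have [n [? ?]] := filter_ex (filterI h1 h2); exists n.
have [fn Dn hn In] := HF n.
exists (F n).1.1, (v_ n), (F n).2; split => //; lra.
Unshelve. all: by end_near. Qed.

End Theory.

Lemma eq_is_integral Z D I f g b : (forall x, Z x -> f x = g x) ->
  is_integral Z D I f b -> is_integral Z D I g b.
Proof.
move=> fg fb e e0; have [f0 [v [chi [fv Dchi f0chi Ichi bv]]]] := fb _ e0.
by exists f0, v, chi; split => // x Zx; rewrite -fg//; exact: f0chi.
Qed.

End AbstractIntegral.

Section Transport.
Variables (R : realType) (T T' : Type) (E : completeNormedModType R).
Variables (Z : set T) (D : set (T -> R)) (I : (T -> R) -> R).
Variables (Z' : set T') (D' : set (T' -> R)) (I' : (T' -> R) -> R).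
Variable theta : T' -> T.
Hypothesis thetaI : forall phi, D phi -> D' (phi \o theta) /\ I' (phi \o theta) = I phi.
Hypothesis thetaZ : forall x, Z' x -> Z (theta x).

(** Used in two ways: with [theta] a left translation, for invariance, and with [theta := id], to
    enlarge the class of integrands. *)
Lemma is_integral_comp (f : T -> E) (b : E) :
  is_integral Z D I f b -> is_integral Z' D' I' (f \o theta) b.
Proof.
have el g u : elementary D I g u -> elementary D' I' (g \o theta) u.
  elim=> [|phi c h v Dphi _ IH]; first exact: elementary0.
  have [D'phi <-] := thetaI Dphi; exact: (elementaryS c D'phi IH).
move=> fb e e0; have [f0 [v [chi [fv Dchi f0chi Ichi bv]]]] := fb _ e0.
have [D'chi I'chi] := thetaI Dchi.
exists (f0 \o theta), v, (chi \o theta); split => //; first exact: el.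
- by move=> x Z'x; exact: f0chi (thetaZ Z'x).
- by rewrite I'chi.
Qed.

End Transport.

(** * Groupoids and their Haar systems *)

Section LocallyCompactSpace.
Variables (R : realType) (G : ptopologicalType).
Hypotheses (hG : hausdorff_space G) (lcG : locally_compact [set: G]).

Lemma compact_nbhs (g : G) : exists2 C, nbhs g C & compact C /\ closed C.
Proof.
have [C gC CC] := @lcG g I; exists C => //.
by apply: filterS (gC : nbhs g [set h | [set: G] h -> C h]) => h; exact.
Qed.

Lemma bump (g : G) (U : set G) : nbhs g U -> exists f : G -> R,
  [/\ continuous f, forall h, 0 <= f h, f g = 1 & forall h, f h != 0 -> U h].
Proof.
move=> gU.
have cB : closed (~` interior U) by exact/open_closedC/open_interior.
have [|f [fc f01 fg fU]] := (uniform_separatorP (R := R) [set g] (~` interior U)).1.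
  by apply: (locally_compact_completely_regular (R := R)) => //; exact.
have f1 h : 0 <= 1 - f h by have := f01 (f h) (ex_intro2 _ _ h I erefl); rewrite /= in_itv/= subr_ge0 => /andP[].
exists (fun h => 1 - f h); split => //.
- by move=> h; apply: cvgB; [exact: cvg_cst|exact: fc].
- by rewrite (_ : f g = 0) ?subr0 //; apply: fg; exists g.
- move=> h fh; apply: interior_subset; apply: contrapT => Uh.
  have f1h : f h = 1 by apply: fU; exists h.
  by move: fh; rewrite f1h subrr eqxx.
Qed.

Lemma continuousM_pt (f k : G -> R) : continuous f -> continuous k -> continuous (fun h => f h * k h).
Proof. by move=> fc kc h; apply: cvgM; [exact: fc|exact: kc]. Qed.

Lemma partition_of_unity (Z : set G) (U : G -> set G) : compact Z ->
  (forall h, Z h -> nbhs h (U h)) ->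
  exists (s : seq G) (psi : G -> G -> R),
  [/\ forall i, i \in s -> Z i,
      forall i, continuous (psi i) /\ forall h, 0 <= psi i h,
      forall h, Z h -> \sum_(i <- s) psi i h = 1,
      forall h, \sum_(i <- s) psi i h <= 1 &
      forall i h, i \in s -> psi i h != 0 -> U i h].
Proof.
move=> cZ ZU.
have H i : exists f : G -> R, [/\ continuous f, forall h, 0 <= f h, Z i -> f i = 1 &
    Z i -> forall h, f h != 0 -> U i h].
  have [Zi|Zi] := pselect (Z i); last first.
    by exists (fun=> 0); split => //; exact: cst_continuous.
  by have [f [? ? ? ?]] := bump (ZU i Zi); exists f.
have [f Hf] := choice H.
have fc i : continuous (f i) by case: (Hf i).
have f0 i h : 0 <= f i h by case: (Hf i).
have [|||D DZ Zcov] := (_ : cover_compact Z) G Z (fun i => f i @^-1` [set y | 2^-1 < y]).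
- by rewrite -compact_cover.
- by move=> i Zi; apply: open_comp; [move=> h _; exact: fc|exact: open_gt].
- by move=> h Zh; exists h => //=; case: (Hf h) => _ _ -> // _; lra.
pose s := finmap.enum_fset D.
pose S h := \sum_(i <- s) f i h.
have S0 h : 0 <= S h by rewrite sumr_ge0.
have Sc : continuous S.
  by move=> h; apply: cvg_big => [|i _]; [exact: add_continuous|exact: fc].
(* Cutting the denominator off at 1/2 keeps the quotients continuous where [S] vanishes and their
   sum at most 1. On [Z] the sum [S] exceeds 1/2, so there the quotients sum to 1. *)
pose m h := Num.max (S h) 2^-1.
have mc : continuous m.
  by move=> h; apply: continuous_max; [exact: Sc|exact: cvg_cst].
have m0 h : 0 < m h by rewrite lt_max [X in _ || X]invr_gt0 ltr0n orbT.
have sumE h : \sum_(i <- s) f i h / m h = S h / m h by rewrite -mulr_suml.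
exists s, (fun i h => f i h / m h); split.
- by move=> i si; exact: set_mem (DZ i si).
- move=> i; split => [|h]; last by rewrite divr_ge0// ltW.
  apply: continuousM_pt => // h; apply: cvgV; last exact: mc.
  by rewrite gt_eqF.
- move=> h Zh; rewrite sumE; have [i Di fi] := Zcov h Zh.
  have Sh : 2^-1 < S h.
    apply: lt_le_trans fi _; rewrite /S (bigD1_seq i)//= ?lerDl ?sumr_ge0//.
    exact: finmap.fset_uniq.
  by rewrite /m max_l ?divff ?(ltW Sh)// gt_eqF// (lt_trans _ Sh)// invr_gt0.
- by move=> h; rewrite sumE ler_pdivrMr// mul1r le_max lexx.
- move=> i h si; rewrite mulf_eq0 negb_or => /andP[fi _].
  have Zi : Z i by exact: set_mem (DZ i si).
  by case: (Hf i) => _ _ _; exact.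
Qed.

Lemma Cc_cutoff (Q : set G) : compact Q ->
  exists chi : G -> R, [/\ Cc chi, forall h, 0 <= chi h & forall h, Q h -> chi h = 1].
Proof.
move=> cQ.
have H (g : G) : exists C, nbhs g C /\ (compact C /\ closed C).
  by have [C ? ?] := compact_nbhs g; exists C.
have [C HC] := choice H.
have [s [psi [sQ psi0 psi1 _ psiC]]] := partition_of_unity cQ (fun h _ => (HC h).1).
exists (fun h => \sum_(i <- s) psi i h); split => //; last first.
  by move=> h; rewrite sumr_ge0// => i _; exact: (psi0 i).2.
split.
  by move=> h; apply: cvg_big => [|i _]; [exact: add_continuous|exact: (psi0 i).1].
pose B := \big[setU/set0]_(i <- s) C i.
have Bc : compact B by apply: bigsetU_compact => i _; exact: (HC i).2.1.
have Bcl : closed B by apply: closed_bigsetU => i _; exact: (HC i).2.2.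
apply: (subclosed_compact (@closed_closure _ _) Bc).
rewrite closureE; apply: smallest_sub => //.
move=> h /= hs; apply: contrapT => Bh; move/negP: hs; apply; apply/eqP.
rewrite big_seq big1// => i si; apply/eqP/negPn/negP => psih; apply: Bh.
by rewrite /B -bigcup_seq; exists i => //; exact: psiC psih.
Qed.

Lemma CcM (f k : G -> R) : continuous f -> Cc k -> Cc (fun h => k h * f h).
Proof.
move=> fc [kc kK]; split; first exact: continuousM_pt.
apply: (subclosed_compact (@closed_closure _ _) kK); apply: closure_subset => h /=.
by apply: contra_neq => ->; rewrite mul0r.
Qed.

Lemma Cc_lin (f k : G -> R) (r : R) : Cc f -> Cc k -> Cc (fun h => r * f h + k h).
Proof.
move=> [fc fK] [kc kK]; split.
  by move=> h; apply: cvgD; [apply: cvgM; [exact: cvg_cst|exact: fc]|exact: kc].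
apply: (subclosed_compact (@closed_closure _ _) (compactU fK kK)).
rewrite -closureU; apply: closure_subset => h /= H.
apply: contrapT => /not_orP[/negP/negPn/eqP fh /negP/negPn/eqP kh].
by move: H; rewrite fh kh mulr0 addr0 eqxx.
Qed.

Lemma Cc0 : Cc (fun _ : G => 0 : R).
Proof.
split; first exact: cst_continuous.
by rewrite (_ : [set _ | _] = set0) ?closure0; [exact: compact0|apply/seteqP; split => // h; rewrite /= eqxx].
Qed.

Lemma Cc_norm (f : G -> R) : Cc f -> Cc (fun h => `|f h|).
Proof.
move=> [fc fK]; split; first by move=> h; apply: cvg_norm; exact: fc.
by under eq_set do rewrite normr_eq0.
Qed.

Lemma Cc_bounded (f : G -> R) : Cc f -> exists M, forall h, `|f h| <= M.
Proof.
move=> [fc fK].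
have [M HM] : exists M, forall h, closure [set g | f g != 0] h -> `|f h| <= M.
  have : bounded_set (f @` (closure [set g | f g != 0])).
    apply: compact_bounded; apply: continuous_compact => //.
    exact: continuous_subspaceT.
  move=> [N [_ /(_ (N + 1))]]; rewrite ltrDl ltr01 => /(_ isT) H.
  by exists (N + 1) => h hK; apply: H; exists h.
exists (Num.max M 0) => h; rewrite le_max; have [->|fh] := eqVneq (f h) 0.
  by rewrite normr0 lexx orbT.
by rewrite HM//; apply: subset_closure.
Qed.

Lemma Cc_bump (g : G) (U : set G) : nbhs g U -> exists f : G -> R,
  [/\ Cc f, forall h, 0 <= f h, f g = 1 & forall h, f h != 0 -> U h].
Proof.
move=> gU; have [C gC [cC clC]] := compact_nbhs g.
have [f [fc f0 fg fU]] := bump (filterI gU gC).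
exists f; split => // [|h /fU[]//]; split => //.
apply: (subclosed_compact (@closed_closure _ _) cC).
by rewrite closureE; apply: smallest_sub => // h /fU[].
Qed.

End LocallyCompactSpace.

(** * The Haar integral on target fibres *)

Section HaarIntegral.
Variables (R : realType) (X : topologicalType) (G : ptopologicalType).
Variables (Gd : groupoid X G) (mu : X -> {measure set (Borel G) -> \bar R}).
Hypothesis HG : locally_compact_groupoid Gd mu.

Local Notation s := (src Gd).
Local Notation t := (tgt Gd).
Local Notation u := (unit Gd).
Local Notation inv := (ginv Gd).

Lemma hausdorff_arrows : hausdorff_space G. Proof. by case: HG => _ _ []. Qed.
Lemma locally_compact_arrows : locally_compact [set: G]. Proof. by case: HG => _ _ []. Qed.
Lemma src_continuous : continuous s. Proof. by case: HG => _ []. Qed.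
Lemma tgt_continuous : continuous t. Proof. by case: HG => _ []. Qed.
Lemma unit_continuous : continuous u. Proof. by case: HG => _ []. Qed.
Lemma ginv_continuous : continuous inv. Proof. by case: HG => _ []. Qed.
Lemma src_unit y : s (u y) = y. Proof. by case: HG => [[/(_ y)[]]]. Qed.
Lemma tgt_unit y : t (u y) = y. Proof. by case: HG => [[/(_ y)[]]]. Qed.
Lemma src_mul g h : s g = t h -> s (gmul Gd g h) = s h.
Proof. by move=> gh; case: HG => [[_ /(_ g h gh)[]]]. Qed.
Lemma tgt_mul g h : s g = t h -> t (gmul Gd g h) = t g.
Proof. by move=> gh; case: HG => [[_ /(_ g h gh)[]]]. Qed.
Lemma gmulA g h k : s g = t h -> s h = t k ->
  gmul Gd (gmul Gd g h) k = gmul Gd g (gmul Gd h k).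
Proof. by move=> gh hk; case: HG => [[_ _ H _ _] _ _ _]; exact: H. Qed.
Lemma gmul1g g : gmul Gd (u (t g)) g = g.
Proof. by case: HG => [[_ _ _ /(_ g)[]]]. Qed.
Lemma gmulg1 g : gmul Gd g (u (s g)) = g.
Proof. by case: HG => [[_ _ _ /(_ g)[]]]. Qed.
Lemma src_inv g : s (inv g) = t g.
Proof. by case: HG => [[_ _ _ _ /(_ g)[]]]. Qed.
Lemma tgt_inv g : t (inv g) = s g.
Proof. by case: HG => [[_ _ _ _ /(_ g)[]]]. Qed.
Lemma gmulgV g : gmul Gd g (inv g) = u (t g).
Proof. by case: HG => [[_ _ _ _ /(_ g)[]]]. Qed.
Lemma gmulKV g h : t g = t h -> gmul Gd g (gmul Gd (inv g) h) = h.
Proof.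
by move=> gh; rewrite -gmulA ?tgt_inv ?src_inv// gmulgV gh gmul1g.
Qed.

Lemma near_gmul g h (O : set G) : s g = t h -> nbhs (gmul Gd g h) O ->
  \forall p \near (g, h), s p.1 = t p.2 -> O (gmul Gd p.1 p.2).
Proof.
move=> gh nO; case: HG => _ [_ _ _ _ /subspace_continuousP mc] _ _.
by have := mc (g, h) gh O nO.
Qed.

Lemma gmul_continuous_within g : {within t @^-1` [set s g], continuous (gmul Gd g)}.
Proof.
apply/subspace_continuousP => h /= hg O nO.
have := near_gmul (esym hg) nO.
move=> [[A B] /= [gA hB]] AB; apply: filterS hB => k Bk /= kg.
by apply: (AB (g, k)) => //; split => //; exact: nbhs_singleton gA.
Qed.

Lemma hausdorff_units : hausdorff_space X.
Proof.
move=> x y xy; rewrite -(src_unit x) -(src_unit y); congr s.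
apply: hausdorff_arrows => A B nA nB.
have [z [Az Bz]] := xy _ _ (unit_continuous nA) (unit_continuous nB).
by exists (u z).
Qed.

Lemma closed_unit1 (y : X) : closed [set y].
Proof. exact/accessible_closed_set1/hausdorff_accessible/hausdorff_units. Qed.

Definition fiber (y : X) : set G := t @^-1` [set y].

Lemma closed_fiber y : closed (fiber y).
Proof. by apply: closed_comp => [h _|]; [exact: tgt_continuous|exact: closed_unit1]. Qed.

Lemma open_Borel (U : set G) : open U -> measurable (U : set (Borel G)).
Proof. exact: sub_sigma_algebra. Qed.

Lemma closed_Borel (U : set G) : closed U -> measurable (U : set (Borel G)).
Proof.
by move=> cU; rewrite -[U]setCK; apply: measurableC; apply: open_Borel; exact: closed_openC.
Qed.

Lemma continuous_within_measurable (D : set G) (f : G -> R) :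
  measurable (D : set (Borel G)) -> {within D, continuous f} ->
  measurable_fun (D : set (Borel G)) (f : Borel G -> R).
Proof.
move=> mD /continuousP cf; apply: (measurability _ (RGenOInfty.measurableE R)).
move=> _ [_ [a ->] <-].
have oa : open (`]a, +oo[%classic : set R) by exact: interval_open.
have /open_subspaceP[V oV VD] := cf _ oa.
rewrite setIC -VD setIC; apply: measurableI => //; exact: open_Borel.
Qed.

(** L1 on the fibre is closed under the translations [f \o gmul Gd g] of functions in [Cc], which
    are continuous on a fibre but uncontrolled elsewhere. *)
Definition fiber_integrable (y : X) : set (G -> R) :=
  [set f | (mu y).-integrable (fiber y : set (Borel G)) (EFin \o (f : Borel G -> R))].

Definition fiber_integral (y : X) (f : G -> R) : R :=
  (\int[mu y]_(h in (fiber y : set (Borel G))) f h)%R.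

Lemma measurable_fiber y : measurable (fiber y : set (Borel G)).
Proof. apply: closed_Borel; exact: closed_fiber. Qed.

Lemma Cc_integrable y (D : set G) f : measurable (D : set (Borel G)) -> Cc f ->
  (mu y).-integrable (D : set (Borel G)) (EFin \o (f : Borel G -> R)).
Proof.
move=> mD cf; have [fc fK] := cf; have [M fM] := Cc_bounded cf.
apply: (@integrableS _ _ _ _ setT) => //.
set K := closure _ in fK.
have mK : measurable (K : set (Borel G)) by apply: closed_Borel; exact: closed_closure.
have -> : EFin \o (f : Borel G -> R) = (EFin \o (f : Borel G -> R)) \_ K.
  apply/funext => h; rewrite patchE; case: ifPn => //= hK.
  rewrite (_ : f h = 0)//.
  by apply: contrapT => /eqP fh; move/negP: hK; apply; rewrite inE; exact: subset_closure.
apply: (integrable_mkcond (EFin \o (f : Borel G -> R)) mK).1; apply: measurable_bounded_integrable => //.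
- by case: HG => _ _ _ [/(_ y)[H _ _] _ _ _]; exact: H.
- by apply: continuous_within_measurable => //; exact: continuous_subspaceT.
- by exists M; split; [exact: num_real|move=> N MN h _ /=; exact: le_trans (fM h) (ltW MN)].
Qed.

Lemma Cc_fiber_integrable y f : Cc f -> fiber_integrable y f.
Proof. by move=> cf; apply: Cc_integrable => //; exact: measurable_fiber. Qed.

(** The complement is open and misses the support, so each of its compact subsets is covered by
    finitely many null open sets. Inner regularity on open sets then makes the complement null. *)
Lemma fiber_complement0 y : mu y (~` fiber y : set (Borel G)) = 0%E.
Proof.
have oF : open (~` fiber y) by apply: closed_openC; exact: closed_fiber.
case: HG => _ _ _ [/(_ y)[_ _ /(_ _ oF) ->] /(_ y) suppE _ _].
have -> : [set mu y K | K in [set K : set G | compact K /\ K `<=` ~` fiber y]] = [set 0%E].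
  apply/seteqP; split => [_ [K [cK KF] <-]|_ ->]; last first.
    by exists set0; rewrite ?measure0//; split; [exact: compact0|exact: sub0set].
  have null h : exists U : set G, K h -> [/\ open U, U h & mu y U = 0%E].
    have [Kh|Kh] := pselect (K h); last by exists set0.
    have : ~ msupport (mu y) h by rewrite suppE; exact: KF.
    move=> /existsNP[U] /not_implyP[oU] /not_implyP[Uh] /negP.
    by rewrite lt0e measure_ge0 andbT negbK => /eqP; exists U.
  have [U HU] := choice null.
  have : cover_compact K by rewrite -compact_cover.
  move=> /(_ _ K U)[|h Kh|D DK KD]; [by move=> h /HU[]|by exists h => //; case: (HU h Kh)|].
  pose B := \big[setU/set0]_(i <- finmap.enum_fset D) U i.
  have [mB B0] : measurable (B : set (Borel G)) /\ mu y (B : set (Borel G)) = 0%E.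
    rewrite /B big_seq; elim/big_ind: _ => [|A B' [mA A0] [mB' B'0]|i iD].
    - by rewrite measure0; split.
    - by split; [exact: measurableU|rewrite null_set_setU].
    - by have /set_mem/HU[oU _ U0] := DK i iD; split => //; exact: open_Borel.
  apply: (@subset_measure0 _ _ _ (mu y) _ (B : set (Borel G))) => //.
    by apply: closed_Borel; apply: compact_closed => //; exact: hausdorff_arrows.
  by move=> h /KD[i /= iD Ui]; rewrite /B -bigcup_seq; exists i.
by rewrite ereal_sup1.
Qed.

Lemma fiber_integralT y f : Cc f ->
  fiber_integral y f = fine (\int[mu y]_(h in [set: Borel G]) (f h)%:E).
Proof.
move=> cf; rewrite /fiber_integral /Rintegral; congr fine.
rewrite (@negligible_integral _ _ _ (mu y) setT (~` fiber y : set (Borel G)))//.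
- by rewrite setDE setCK setTI.
- by apply: measurableC; exact: measurable_fiber.
- exact: Cc_integrable.
- exact: fiber_complement0.
Qed.

Lemma fiber_positive_functional y :
  positive_functional (fiber y) (fiber_integrable y) (fiber_integral y).
Proof.
have mF := measurable_fiber y.
split.
- by apply: Cc_integrable => //; exact: Cc0.
- move=> r phi chi iphi ichi.
  rewrite /fiber_integrable /= (_ : EFin \o _ = fun h => (r%:E * (EFin \o phi) h + (EFin \o chi) h)%E)//.
  by apply: integrableD => //; apply: integrableZl.
- move=> r phi chi iphi ichi; rewrite /fiber_integral RintegralD// ?RintegralZl//.
  by rewrite /comp; under eq_fun do rewrite EFinM; apply: integrableZl.
- by move=> phi chi iphi ichi H; apply: le_Rintegral.
Qed.

Lemma fiber_integral_continuous f : Cc f -> continuous (fun y => fiber_integral y f).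
Proof.
move=> cf; rewrite (_ : (fun y => _) = fun y => fine (\int[mu y]_(h in [set: Borel G]) (f h)%:E)%E).
  by case: HG => _ _ _ [_ _ _]; exact.
by apply/funext => y; rewrite fiber_integralT.
Qed.

Lemma fiber_integral_translate g f : Cc f ->
  fiber_integrable (s g) (f \o gmul Gd g) /\
  fiber_integral (s g) (f \o gmul Gd g) = fiber_integral (t g) f.
Proof.
move=> cf; have inv := (let: And4 _ _ H _ := (let: And4 _ _ _ H := HG in H) in H).
split; last by rewrite /fiber_integral /Rintegral; congr fine; exact: inv.
apply/integrableP; split.
  apply/measurable_EFinP; apply: continuous_within_measurable.
    exact: measurable_fiber.
  apply/subspace_continuousP => h hs.
  have /subspace_continuousP/(_ h hs) mc := @gmul_continuous_within g.
  exact: cvg_comp mc (cf.1 _).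
(* Invariance for the absolute value of [f] makes the integral of the translate finite. *)
have := inv g (fun h => `|f h|) (Cc_norm cf).
under eq_integral do rewrite -[(_)%:E]/(`|(f (gmul Gd g _))%:E|)%E.
move=> /= ->.
by have /integrableP[] := Cc_integrable (t g) (measurable_fiber (t g)) cf.
Qed.

(** The arrow [h] belongs to the support of the measure over its target, so the open set where [f]
    exceeds [f h / 2] has positive measure. *)
Lemma fiber_integral_gt0 f h : Cc f -> (forall k, 0 <= f k) -> 0 < f h ->
  0 < fiber_integral (t h) f.
Proof.
move=> cf f0 fh; have [fc _] := cf; pose U := [set k | f h / 2 < f k].
have oU : open U by apply: (@open_comp _ _ f [set r : R | f h / 2 < r]); [move=> k _; exact: fc|exact: open_gt].
have mU := open_Borel oU.
have muU : (0 < mu (t h) U)%E.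
  have : msupport (mu (t h)) h by case: HG => _ _ _ [_ -> _ _].
  by apply => //; rewrite /U /=; lra.
rewrite fiber_integralT//.
have iU : (mu (t h)).-integrable (U : set (Borel G)) (EFin \o (f : Borel G -> R)) by exact: Cc_integrable.
have iT : (mu (t h)).-integrable setT (EFin \o (f : Borel G -> R)) by exact: Cc_integrable.
rewrite fine_gt0//; apply/andP; split; last first.
  by rewrite ltey_eq; rewrite integrable_fin_num.
apply: (@lt_le_trans _ _ (\int[mu (t h)]_(k in (U : set (Borel G))) (f h / 2)%:E)%E).
  rewrite integral_cst//= mule_gt0// lte_fin; lra.
apply: (@le_trans _ _ (\int[mu (t h)]_(k in (U : set (Borel G))) (f k)%:E)%E).
  apply: ge0_le_integral => //.
  - by move=> k _; rewrite lee_fin; lra.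
  - by have /integrableP[] := iU.
  - by move=> k Uk; rewrite lee_fin ltW.
apply: ge0_subset_integral => //; first by have /integrableP[] := iT.
by move=> k _; rewrite lee_fin.
Qed.

Lemma fiber_integral_eq0 y f : (forall k, t k = y -> f k = 0) -> fiber_integral y f = 0.
Proof.
move=> H; rewrite /fiber_integral /Rintegral (eq_integral (cst 0%E)) ?integral0//.
by move=> k; rewrite inE => /H ->.
Qed.

End HaarIntegral.

(** * Uniformity over compact sets of arrows near the isotropy group *)

Lemma hausdorff_separation (Y : topologicalType) (x y : Y) : hausdorff_space Y -> x <> y ->
  exists A B, [/\ nbhs x A, nbhs y B & forall z, A z -> B z -> False].
Proof.
move=> hY xy; apply: contrapT => H; apply: xy; apply: hY => A B nA nB.
apply: contrapT => AB; apply: H; exists A, B; split => // z Az Bz.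
by apply: AB; exists z.
Qed.

(** A form of the tube lemma. Points of [Q] off the fibre over [x] stay off nearby fibres because
    [X'] is Hausdorff, points on it satisfy [P] nearby, and compactness of [Q] makes both
    uniform. *)
Lemma near_fiber (Y X' : topologicalType) (theta : Y -> X') (Q : set Y) (P : Y -> Prop) (x : X') :
  hausdorff_space X' -> continuous theta -> compact Q ->
  (forall q, theta q = x -> \forall q' \near q, P q') ->
  \forall x' \near x, forall q, Q q -> theta q = x' -> P q.
Proof.
move=> hX thetac /compact_near_coveringP cQ H.
apply: (cQ X' (nbhs x) (fun x' q => theta q = x' -> P q)) => q Qq.
have [qx|qx] := pselect (theta q = x).
  exists ([set q' | P q'], setT); first by split; [exact: H|exact: filterT].
  by move=> [q' x'] [].
have [A [B [Aq Bx AB]]] := hausdorff_separation hX qx.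
exists (theta @^-1` A, B); first by split => //; exact: thetac.
move=> [q' x'] /= [Aq' Bx'] qx'; exfalso.
by apply: AB Aq' _; rewrite qx'.
Qed.

Lemma hausdorff_prod (Y Z : topologicalType) :
  hausdorff_space Y -> hausdorff_space Z -> hausdorff_space (Y * Z)%type.
Proof.
move=> hY hZ [y z] [y' z'] yz; congr (_, _).
  apply: hY => A B nA nB.
  have [||[a b] [/= [Aa _] [Ba _]]] := yz (A `*` setT) (B `*` setT); last by exists a.
    by exists (A, setT) => //; split => //; exact: filterT.
  by exists (B, setT) => //; split => //; exact: filterT.
apply: hZ => A B nA nB.
have [||[a b] [/= [_ Ab] [_ Bb]]] := yz (setT `*` A) (setT `*` B); last by exists b.
  by exists (setT, A) => //; split => //; exact: filterT.
by exists (setT, B) => //; split => //; exact: filterT.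
Qed.

Section LocalGeometry.
Variables (R : realType) (X : topologicalType) (G : ptopologicalType).
Variables (Gd : groupoid X G) (mu : X -> {measure set (Borel G) -> \bar R}).
Hypothesis HG : locally_compact_groupoid Gd mu.

Local Notation s := (src Gd).
Local Notation t := (tgt Gd).
Local Notation u := (unit Gd).
Local Notation m := (gmul Gd).
Local Notation inv := (ginv Gd).
Local Notation hG := (hausdorff_arrows HG).
Local Notation lcG := (locally_compact_arrows HG).
Local Notation hX := (hausdorff_units HG).
Local Notation sc := (src_continuous HG).
Local Notation tc := (tgt_continuous HG).

(* The target map is open because the fibre integral of a bump function depends
   continuously on the unit. *)
Lemma tgt_open (h : G) (B : set G) : nbhs h B -> nbhs (t h) (t @` B).
Proof.
move=> hB; have [f [cf f0 fh fB]] := Cc_bump R hG lcG hB.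
have pos : 0 < fiber_integral Gd mu (t h) f by apply: fiber_integral_gt0 => //; rewrite fh.
have cI : fiber_integral Gd mu y f @[y --> t h] --> fiber_integral Gd mu (t h) f.
  exact: fiber_integral_continuous.
apply: filterS (cvgr_gt _ cI _ pos) => y /= Iy.
apply: contrapT => yB; move: Iy; rewrite fiber_integral_eq0 ?ltxx// => k tk.
by apply: contrapT => /eqP fk; apply: yB; exists k => //; exact: fB.
Qed.

Lemma closed_composable : closed (composable Gd).
Proof.
move=> [g h] cl; apply: contrapT => gh.
have [A [B [nA nB AB]]] := hausdorff_separation hX gh.
have nAB : nbhs (g, h) ((s @^-1` A) `*` (t @^-1` B)).
  by exists (s @^-1` A, t @^-1` B) => //; split; [exact: sc|exact: tc].
have [[g' h'] [/= c' [Ag' Bh']]] := cl _ nAB.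
by apply: AB Ag' _; rewrite (c' : s g' = t h').
Qed.

Definition set_gmul (A B : set G) := [set m p.1 p.2 | p in (A `*` B) `&` composable Gd].

Lemma compact_set_gmul A B : compact A -> compact B -> compact (set_gmul A B).
Proof.
move=> cA cB; apply: continuous_compact; last first.
  by apply: compact_closedI; [exact: compact_setX|exact: closed_composable].
apply: (@continuous_subspaceW _ _ _ (composable Gd)); first by move=> p [].
by case: HG => _ [].
Qed.

Lemma compact_isotropy_neighborhood (x : X) : proper_groupoid R Gd ->
  exists (V : set X) (Q : set G), [/\ nbhs x V, compact Q & restriction Gd V `<=` Q].
Proof.
move=> [c [cc c0 ccomp corb]].
have [g0 [sg0 cg0]] := corb x.
pose h0 := inv g0.
have th0 : t h0 = x by rewrite (tgt_inv HG).
have sh0 : s h0 = t g0 by rewrite (src_inv HG).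
have [C nC [cC clC]] := compact_nbhs lcG h0.
have csc : continuous (c \o s) by move=> h; apply: continuous_comp; [exact: sc|exact: cc].
pose B := C `&` (c \o s) @^-1` [set r | c (t g0) / 2 <= r].
have cB : compact B.
  apply: compact_closedI => //; apply: closed_comp => [h _|]; [exact: csc|exact: closed_ge].
have nB : nbhs h0 B.
  apply: filterI => //.
  have csc0 : (c \o s) h @[h --> h0] --> (c \o s) h0 by exact: csc.
  have lt0 : c (t g0) / 2 < (c \o s) h0 by rewrite /= sh0; lra.
  by apply: filterS (cvgr_gt _ csc0 _ lt0) => h /ltW.
pose L := closure [set g : G | c (s g) != 0] `&` t @^-1` (s @` B).
have cL : compact L.
  apply: ccomp; apply: continuous_compact => //.
  by apply: continuous_subspaceT; exact: sc.
exists (t @` B), (set_gmul (set_gmul B L) (inv @` B)); split.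
- by rewrite -th0; exact: tgt_open.
- apply: compact_set_gmul; first exact: compact_set_gmul.
  apply: continuous_compact => //.
  by apply: continuous_subspaceT; exact: (ginv_continuous HG).
move=> g [[h' Bh' th'] [h Bh th]].
pose k := m (m (inv h) g) h'.
have e1 : s (inv h) = t g by rewrite (src_inv HG).
have e2 : s (m (inv h) g) = t h' by rewrite (src_mul HG).
have sk : s k = s h' by rewrite /k (src_mul HG).
have tk : t k = s h by rewrite /k (tgt_mul HG)// (tgt_mul HG)// (tgt_inv HG).
have Lk : L k.
  split; last by rewrite /= tk; exists h.
  apply: subset_closure; rewrite /= sk gt_eqF//.
  by apply: lt_le_trans Bh'.2 => /=; lra.
have e3 : s h = t k by [].
have e4 : s (m h k) = t (inv h') by rewrite (src_mul HG)// (tgt_inv HG).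
exists (m h k, inv h').
  split; last exact: e4.
  split => /=; last by exists h'.
  by exists (h, k).
have hk : m h k = m g h'.
  by rewrite /k -(gmulA HG) ?(tgt_mul HG)// ?(tgt_inv HG)// (gmulKV HG).
by rewrite /= hk (gmulA HG) ?(tgt_inv HG)// (gmulgV HG) th' (gmulg1 HG).
Qed.

(** Local compactness is assumed of the arrow space only, so bump functions on [X] are obtained
    there and restricted along the unit map. *)
Lemma unit_bump (x : X) (V : set X) : nbhs x V -> exists w : X -> R,
  [/\ continuous w, forall y, 0 <= w y, w x = 1 & forall y, w y != 0 -> V y].
Proof.
move=> nV; have nsV : nbhs (u x) (s @^-1` V) by apply: sc; rewrite (src_unit HG).
have [f [fc f0 fx fV]] := bump R hG lcG nsV.
exists (f \o u); split => //= y.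
- by apply: continuous_comp; [exact: (unit_continuous HG)|exact: fc].
- by move=> /fV; rewrite /= (src_unit HG).
Qed.

(** This is [near_fiber] for the map sending a pair of arrows to its four end points: on [Q] times
    [Q], its fibre over the constant value [x] consists of pairs of isotropy arrows. *)
Lemma near_isotropy (x : X) (Q : set G) (V : set X) (P : G -> G -> Prop) :
  nbhs x V -> compact Q -> restriction Gd V `<=` Q ->
  (forall k l, isotropy Gd x k -> isotropy Gd x l -> \forall p \near (k, l), P p.1 p.2) ->
  exists2 W, nbhs x W & forall g h, restriction Gd W g -> restriction Gd W h -> P g h.
Proof.
move=> nV cQ VQ H.
pose theta (p : G * G) := ((s p.1, t p.1), (s p.2, t p.2)).
have thetac : continuous theta.
  have cst1 (g : G) : (s h, t h) @[h --> g] --> (s g, t g) by apply: cvg_pair; [exact: sc|exact: tc].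
  move=> p; apply: (@cvg_pair _ _ _ _ (nbhs (s p.1, t p.1)) (nbhs (s p.2, t p.2))).
  - by apply: (@cvg_comp _ _ _ _ (fun g => (s g, t g)) _ _ _ cvg_fst); exact: cst1.
  - by apply: (@cvg_comp _ _ _ _ (fun g => (s g, t g)) _ _ _ cvg_snd); exact: cst1.
have hXX := hausdorff_prod hX hX.
have [|[A B] /= [[[A1 A2] /= [nA1 nA2] A12] [[B1 B2] /= [nB1 nB2] B12]] AB] :=
  near_fiber (P := fun p => P p.1 p.2) (x := ((x, x), (x, x)))
    (hausdorff_prod hXX hXX) thetac (compact_setX cQ cQ).
  by move=> [k l] [sk tk sl tl]; exact: H.
exists (V `&` (A1 `&` A2 `&` (B1 `&` B2))).
  by apply: filterI => //; apply: filterI; apply: filterI.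
move=> g h [[Vsg [[A1g _] _]] [Vtg [[_ A2g] _]]] [[Vsh [_ [B1h _]]] [Vth [_ [_ B2h]]]].
apply: (AB ((s g, t g), (s h, t h)) _ (g, h)) => //.
  by split => /=; [apply: A12|apply: B12].
by split => /=; apply: VQ.
Qed.

End LocalGeometry.

(** * Averaging near representations *)

Section OperatorConvergence.
Variables (R : realType) (E : completeNormedModType R).
Implicit Types (T S : E -> E).

Definition linear_map T :=
  (forall x y, T (x + y) = T x + T y) /\ (forall (r : R) x, T (r *: x) = r *: T x).

(** Operators remain plain functions on [E]; bounds and distances in operator norm are explicit
    inequalities, which also make sense for families that are controlled on a subset only. *)
Definition op_bound T c := forall e, `|T e| <= c * `|e|.

Definition op_near (c : R) T S := forall e, `|T e - S e| <= c * `|e|.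

Definition op_cvg (I : Type) (F : set_system I) (T : I -> E -> E) (T0 : E -> E) :=
  forall eps : R, 0 < eps -> \forall i \near F, op_near eps (T i) T0.

Lemma linear_mapB T x y : linear_map T -> T (x - y) = T x - T y.
Proof. by move=> [TD TZ]; rewrite TD -scaleN1r TZ scaleN1r. Qed.

Lemma linear_map0 T : linear_map T -> T 0 = 0.
Proof. by move=> lT; have := linear_mapB 0 0 lT; rewrite !subrr. Qed.

Lemma linear_map_inv T S : linear_map T -> cancel T S -> cancel S T -> linear_map S.
Proof.
move=> [TD TZ] TS ST; split=> [x y|r x].
  by rewrite -{1}(ST x) -{1}(ST y) -TD TS.
by rewrite -{1}(ST x) -TZ TS.
Qed.

Lemma linear_map_comp T S : linear_map T -> linear_map S -> linear_map (T \o S).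
Proof. by move=> [TD TZ] [SD SZ]; split=> [x y|r x] /=; rewrite ?SD ?SZ ?TD ?TZ. Qed.

Lemma op_bound_comp T S c d : op_bound T c -> op_bound S d -> 0 <= c -> op_bound (T \o S) (c * d).
Proof.
move=> Tc Sd c0 e /=; apply: le_trans (Tc _) _; rewrite -mulrA.
by rewrite ler_wpM2l.
Qed.

Lemma op_bound_pos T c : op_bound T c -> exists2 d, 0 < d & op_bound T d.
Proof.
move=> Tc; exists (`|c| + 1); first by rewrite ltr_pwDr.
move=> e; apply: le_trans (Tc e) _; rewrite ler_wpM2r//.
by apply: le_trans (ler_norm c) _; rewrite lerDl.
Qed.

Lemma op_near_trans c d T S U : op_near c T S -> op_near d S U -> op_near (c + d) T U.
Proof.
move=> TS SU e; rewrite mulrDl -(subrK (S e) (T e)) -addrA.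
by apply: le_trans (ler_normD _ _) _; rewrite lerD.
Qed.

Lemma op_near_sym c T S : op_near c T S -> op_near c S T.
Proof. by move=> TS e; rewrite distrC. Qed.

Lemma op_near_le c d T S : c <= d -> op_near c T S -> op_near d T S.
Proof. by move=> cd TS e; apply: le_trans (TS e) _; rewrite ler_wpM2r. Qed.

Lemma op_near_bound c d T S : op_near c T S -> op_bound S d -> op_bound T (c + d).
Proof.
move=> TS Sd e; rewrite mulrDl -{1}(subrK (S e) (T e)).
by apply: le_trans (ler_normD _ _) _; rewrite lerD.
Qed.

Lemma op_cvg_reindex (I J : Type) (F : set_system I) (F' : set_system J) (f : I -> J)
    (T : J -> E -> E) T0 :
  f @ F --> F' -> op_cvg F' T T0 -> op_cvg F (T \o f) T0.
Proof. by move=> fF TT0 eps eps0; have := fF _ (TT0 eps eps0). Qed.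

Section Filter.
Variables (I : Type) (F : set_system I).
Context {FF : Filter F}.

Lemma op_cvg_cst T : op_cvg F (fun=> T) T.
Proof. by move=> eps e0; apply: filterE => i e; rewrite subrr normr0 mulr_ge0// ltW. Qed.

Lemma op_cvg_comp (T : I -> E -> E) T0 c (S : I -> E -> E) S0 d : linear_map T0 -> op_bound T0 c -> op_bound S0 d ->
  op_cvg F T T0 -> op_cvg F S S0 -> op_cvg F (fun i => T i \o S i) (T0 \o S0).
Proof.
move=> lT /op_bound_pos[{}c c0 Tc] /op_bound_pos[{}d d0 Sd] TT0 SS0 eps eps0.
(* The error is (T i - T0) S i + T0 (S i - S0). The bound 1 in [e2] keeps [S i] within d + 1, the
   other bound controls the second term, and [e1] the first. *)
pose e1 := eps / 2 / (d + 1); pose e2 := Num.min 1 (eps / 2 / c).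
have e10 : 0 < e1 by rewrite !divr_gt0// addr_gt0.
have e20 : 0 < e2 by rewrite lt_min ltr01 !divr_gt0.
near=> i => e /=.
have H1 : op_near e1 (T i) T0 by near: i; exact: TT0.
have H2 : op_near e2 (S i) S0 by near: i; exact: SS0.
have Si : `|S i e| <= (d + 1) * `|e|.
  apply: le_trans (op_near_bound H2 Sd e) _; rewrite ler_wpM2r// addrC lerD2l.
  by rewrite ge_min lexx.
rewrite -(subrK (T0 (S i e)) (T i (S i e))) -addrA.
apply: le_trans (ler_normD _ _) _; rewrite -linear_mapB//.
have h1 : `|T i (S i e) - T0 (S i e)| <= eps / 2 * `|e|.
  apply: le_trans (H1 _) _; rewrite /e1.
  have -> : eps / 2 * `|e| = eps / 2 / (d + 1) * ((d + 1) * `|e|).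
    by rewrite mulrA divfK// gt_eqF// addr_gt0.
  by rewrite ler_wpM2l// ltW.
have h2 : `|T0 (S i e - S0 e)| <= eps / 2 * `|e|.
  apply: le_trans (Tc _) _.
  have -> : eps / 2 * `|e| = c * (eps / 2 / c * `|e|).
    by rewrite mulrA [c * _]mulrC divfK// gt_eqF.
  rewrite ler_wpM2l ?(ltW c0)//; apply: le_trans (H2 e) _.
  by rewrite ler_wpM2r// ge_min lexx orbT.
by rewrite (splitr eps) mulrDl lerD.
Unshelve. all: by end_near. Qed.

Lemma op_cvgD (T : I -> E -> E) T0 (S : I -> E -> E) S0 : op_cvg F T T0 -> op_cvg F S S0 ->
  op_cvg F (fun i e => T i e + S i e) (fun e => T0 e + S0 e).
Proof.
move=> TT0 SS0 eps eps0; have e20 : 0 < eps / 2 by lra.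
near=> i => e.
have H1 : op_near (eps / 2) (T i) T0 by near: i; exact: TT0.
have H2 : op_near (eps / 2) (S i) S0 by near: i; exact: SS0.
rewrite opprD addrACA; apply: le_trans (ler_normD _ _) _.
by rewrite (splitr eps) mulrDl lerD.
Unshelve. all: by end_near. Qed.

Lemma op_cvg_scale (r : I -> R) (r0 : R) : r i @[i --> F] --> r0 ->
  op_cvg F (fun i e => r i *: e) (fun e => r0 *: e).
Proof.
move=> rr0 eps eps0; near=> i => e.
rewrite -scalerBl normrZ ler_wpM2r// distrC.
by near: i; exact: (cvgr_dist_le _ _ rr0 _ eps0).
Unshelve. all: by end_near. Qed.

Lemma op_bound_scale (r : R) : op_bound (fun e => r *: e) `|r|.
Proof. by move=> e; rewrite normrZ. Qed.

Lemma linear_map_scale (r : R) : linear_map (fun e => r *: e).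
Proof. by split=> [x y|a x]; rewrite ?scalerDr// !scalerA mulrC. Qed.

Lemma op_cvg_sum (J : Type) (l : seq J) (r : J -> I -> R) (r0 : J -> R) (T : J -> E -> E) :
  (forall j, exists c, op_bound (T j) c) ->
  (forall j, r j i @[i --> F] --> r0 j) ->
  op_cvg F (fun i e => \sum_(j <- l) r j i *: T j e) (fun e => \sum_(j <- l) r0 j *: T j e).
Proof.
move=> Tb rr0; elim: l => [|j l IH].
  have -> : (fun i e => \sum_(j <- [::]) r j i *: T j e) = fun _ _ => 0.
    by apply/funext => i; apply/funext => e; rewrite big_nil.
  have -> : (fun e => \sum_(j <- [::]) r0 j *: T j e) = fun=> 0.
    by apply/funext => e; rewrite big_nil.
  exact: op_cvg_cst.
have -> : (fun i e => \sum_(k <- j :: l) r k i *: T k e) =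
    fun i e => r j i *: T j e + \sum_(k <- l) r k i *: T k e.
  by apply/funext => i; apply/funext => e; rewrite big_cons.
have -> : (fun e => \sum_(k <- j :: l) r0 k *: T k e) =
    fun e => r0 j *: T j e + \sum_(k <- l) r0 k *: T k e.
  by apply/funext => e; rewrite big_cons.
apply: op_cvgD => //; have [c Tc] := Tb j.
apply: (@op_cvg_comp (fun i e => r j i *: e) (fun e => r0 j *: e) `|r0 j| (fun=> T j) (T j) c) => //.
- exact: linear_map_scale.
- exact: op_bound_scale.
- exact: op_cvg_scale.
- exact: op_cvg_cst.
Qed.

(** By the identity T' i - T0' = T' i (T0 - T i) T0', a uniform bound on the inverses transfers
    convergence to them. *)
Lemma op_cvg_inv (T T' : I -> E -> E) (T0 T0' : E -> E) M :
  (\forall i \near F, [/\ linear_map (T i), cancel (T i) (T' i), cancel (T' i) (T i) & op_bound (T' i) M]) ->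
  cancel T0' T0 -> op_bound T0' M -> op_cvg F T T0 -> op_cvg F T' T0'.
Proof.
move=> HT K0 /op_bound_pos[d d0 bT0'] TT0 eps eps0.
pose e1 := eps / (d * (`|M| + 1)).
have M0 : 0 < `|M| + 1 by rewrite ltr_pwDr.
have e10 : 0 < e1 by rewrite divr_gt0// mulr_gt0.
near=> i => e.
have [lT K1 K2 bT] : [/\ linear_map (T i), cancel (T i) (T' i), cancel (T' i) (T i) & op_bound (T' i) M] by near: i.
have H : op_near e1 (T i) T0 by near: i; exact: TT0.
have lT' := linear_map_inv lT K1 K2.
have -> : T' i e - T0' e = T' i (T0 (T0' e) - T i (T0' e)) by rewrite linear_mapB// K1 K0.
apply: le_trans (bT _) _.
have -> : eps * `|e| = (`|M| + 1) * (e1 * (d * `|e|)).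
  by rewrite /e1; field; rewrite !gt_eqF.
apply: (@le_trans _ _ ((`|M| + 1) * `|T0 (T0' e) - T i (T0' e)|)).
  by rewrite ler_wpM2r//; apply: le_trans (ler_norm M) _; rewrite lerDl.
rewrite ler_wpM2l ?(ltW M0)// distrC; apply: le_trans (H _) _.
by rewrite ler_wpM2l ?(ltW e10).
Unshelve. all: by end_near. Qed.

End Filter.

End OperatorConvergence.

Section BanachModule.
Variables (R : realType) (A : completeNormedModType R) (amul : A -> A -> A) (aone : A).
Variables (E : completeNormedModType R) (act : A -> E -> E).
Hypothesis HE : banach_module amul aone act.

Lemma act_linear a : linear_map (act a).
Proof. by case: HE => D _ Z _ _; split=> [x y|r x]; [exact: D|exact: (Z r a x).2]. Qed.

Lemma actDl a b e : act (a + b) e = act a e + act b e.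
Proof. by case: HE. Qed.

Lemma actM a b e : act (amul a b) e = act a (act b e).
Proof. by case: HE. Qed.

Lemma act1 e : act aone e = e.
Proof. by case: HE => _ _ _ _ []. Qed.

Lemma act_bound a : op_bound (act a) `|a|.
Proof. by move=> e; case: HE => _ _ _ _ []. Qed.

Lemma actBl a b e : act (a - b) e = act a e - act b e.
Proof.
rewrite actDl; congr (_ + _); case: HE => _ _ Z _ _.
by rewrite -scaleN1r (Z _ _ _).1 scaleN1r.
Qed.

Lemma act_cvg (I : Type) (F : set_system I) (FF : Filter F) (a : I -> A) (a0 : A) :
  a i @[i --> F] --> a0 -> op_cvg F (act \o a) (act a0).
Proof.
move=> aa0 eps eps0; near=> i => e /=; rewrite -actBl.
apply: le_trans (act_bound _ _) _; rewrite ler_wpM2r// distrC.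
by near: i; exact: (cvgr_dist_le _ _ aa0 _ eps0).
Unshelve. all: by end_near. Qed.

Definition A_linear (T : E -> E) := linear_map T /\ forall a e, T (act a e) = act a (T e).

Lemma A_linear_comp T S : A_linear T -> A_linear S -> A_linear (T \o S).
Proof.
by move=> [lT aT] [lS aS]; split; [exact: linear_map_comp|move=> a e /=; rewrite aS aT].
Qed.

Lemma A_linear_inv T S : A_linear T -> cancel T S -> cancel S T -> A_linear S.
Proof.
move=> [lT aT] TS ST; split; first exact: linear_map_inv TS ST.
by move=> a e; rewrite -{1}(ST e) -aT TS.
Qed.

Lemma A_linear_act a : central amul a -> A_linear (act a).
Proof.
by move=> ca; split; [exact: act_linear|move=> b e; rewrite -!actM ca].
Qed.

End BanachModule.

Section NearRepresentation.
Variables (R : realType) (X : topologicalType) (G : ptopologicalType).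
Variables (Gd : groupoid X G).
Variables (A : completeNormedModType R) (sigma : G -> G -> A).
Variables (E : completeNormedModType R) (act : A -> E -> E).
Implicit Types (H : set G) (T S : G -> E -> E).

Definition bounded_family H T :=
  forall g, H g -> A_linear act (T g) /\ exists c, op_bound (T g) c.

Definition continuous_family H T :=
  forall g, H g -> op_cvg (within H (nbhs g)) T (T g).

Definition inverse_family H T S (M : R) :=
  forall g, H g -> [/\ cancel (T g) (S g), cancel (S g) (T g) & op_bound (S g) M].

Definition defect_le H T (delta : R) :=
  forall g h, H g -> H h -> src Gd g = tgt Gd h ->
    op_near delta (T g \o T h) (act (sigma g h) \o T (gmul Gd g h)).

End NearRepresentation.

(** * The average of a near representation: existence, continuity and defect *)

Section Averaging.
Variables (R : realType) (X : topologicalType) (G : ptopologicalType).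
Variables (Gd : groupoid X G) (mu : X -> {measure set (Borel G) -> \bar R}).
Hypothesis HG : locally_compact_groupoid Gd mu.
Variables (A : completeNormedModType R) (amul : A -> A -> A) (aone : A).
Variables (sigma : G -> G -> A) (E : completeNormedModType R) (act : A -> E -> E).
Hypotheses (Hsigma : multiplier Gd amul aone sigma) (HE : banach_module amul aone act).
Variables (w : X -> R) (Q : set G) (chi : G -> R).
Hypotheses (wc : continuous w) (w_ge0 : forall y, 0 <= w y).
Hypotheses (chic : Cc chi) (chi_ge0 : forall h, 0 <= chi h) (chiQ : forall h, Q h -> chi h = 1).

Local Notation s := (src Gd).
Local Notation t := (tgt Gd).
Local Notation u := (unit Gd).
Local Notation m := (gmul Gd).
Local Notation sc := (src_continuous HG).
Local Notation tc := (tgt_continuous HG).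
Local Notation V := [set y | w y != 0].
Local Notation H := (restriction Gd V).
Local Notation I := (fiber_integral Gd mu).

Hypothesis HQ : H `<=` Q.

Lemma restriction_mul g h : H g -> H h -> s g = t h -> H (m g h).
Proof. by move=> [sg tg] [sh th] gh; rewrite /restriction /= (src_mul HG)// (tgt_mul HG). Qed.

Lemma restriction_unit y : V y -> H (u y).
Proof. by move=> Vy; rewrite /restriction /= (src_unit HG) (tgt_unit HG). Qed.

(** Over a point of [V] the weight lives on [H], where [chi] is 1. The factor [chi] only makes the
    weight compactly supported on all of [G]. *)
Lemma weight_cutoff h : V (t h) -> chi h * w (s h) = w (s h).
Proof.
move=> Vth; have [->|ws] := eqVneq (w (s h)) 0; first by rewrite mulr0.
by rewrite chiQ ?mul1r//; apply: HQ.
Qed.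

Lemma Cc_weight : Cc (fun h => chi h * w (s h)).
Proof. by apply: CcM => // h; apply: continuous_comp; [exact: sc|exact: wc]. Qed.

Definition mass (y : X) : R := I y (fun h => chi h * w (s h)).

Lemma mass_gt0 y : V y -> 0 < mass y.
Proof.
move=> Vy; rewrite /mass -{1}(tgt_unit HG y); apply: fiber_integral_gt0 => //.
- exact: Cc_weight.
- by move=> k; rewrite mulr_ge0.
- by rewrite weight_cutoff /= ?(tgt_unit HG) ?(src_unit HG)// lt_def w_ge0 andbT.
Qed.

(** Left translation keeps sources, hence keeps the weight [w (s h)]. *)
Lemma mass_invariant g : H g -> mass (s g) = mass (t g).
Proof.
move=> [Vsg Vtg]; have [_ Ig] := fiber_integral_translate HG g Cc_weight.
apply: etrans Ig; rewrite /mass /fiber_integral; apply: eq_Rintegral => h; rewrite inE /fiber /= => th.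
by rewrite !weight_cutoff ?(src_mul HG) ?(tgt_mul HG)// /= th.
Qed.

Lemma mass_continuous : continuous mass.
Proof. exact: fiber_integral_continuous Cc_weight. Qed.

(** Existence is proved with approximants in [Cc], whose translates are again integrable by
    [fiber_integral_translate]. Integrals on the same fibre, translated or not, are then compared as
    [L1_integral]. *)
Definition Cc_integral y f b := is_integral (E := E) (fiber Gd y) [set f | Cc f] (I y) f b.
Definition L1_integral y f b :=
  is_integral (E := E) (fiber Gd y) (fiber_integrable Gd mu y) (I y) f b.

Lemma Cc_positive_functional y : positive_functional (fiber Gd y) [set f | Cc f] (I y).
Proof.
have [_ _ Il Ile] := fiber_positive_functional HG y.
have iC f : Cc f -> fiber_integrable Gd mu y f.
  exact: Cc_fiber_integrable.
split => [|r f k cf ck|r f k cf ck|f k cf ck fk].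
- exact: Cc0.
- exact: Cc_lin.
- by apply: Il; exact: iC.
- by apply: Ile => //; exact: iC.
Qed.

Lemma Cc_L1_integral y f b : Cc_integral y f b -> L1_integral y f b.
Proof.
apply: (is_integral_comp (theta := id)) => // phi cphi; split => //.
exact: Cc_fiber_integrable.
Qed.

Lemma translate_integral g f b : Cc_integral (t g) f b -> L1_integral (s g) (f \o m g) b.
Proof.
apply: is_integral_comp => [phi cphi|h]; first exact: fiber_integral_translate.
by rewrite /fiber /= => th; rewrite (tgt_mul HG).
Qed.

Variables (T S : G -> E -> E) (M delta : R).
Hypotheses (M_gt0 : 0 < M) (delta_ge0 : 0 <= delta).
Hypotheses (Tb : bounded_family act H T) (Tc : continuous_family H T).
Hypotheses (TS : inverse_family H T S M) (Td : defect_le Gd sigma act H T delta).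

(** For an exact sigma-representation with [S h] inverse to [T h] this is [T g], whatever [h] is.
    Its dependence on [h] measures the defect. *)
Definition quotient_op g h : E -> E := act (sigma g h) \o (T (m g h) \o S h).

Definition integrand g e h : E := w (s h) *: quotient_op g h e.

Lemma T_linear g : H g -> linear_map (T g).
Proof. by move=> /Tb[[]]. Qed.

Lemma S_A_linear h : H h -> A_linear act (S h).
Proof. by move=> Hh; have [aT _] := Tb Hh; have [TSh STh _] := TS Hh; exact: A_linear_inv TSh STh. Qed.

Lemma quotient_op_A_linear g h : H g -> H h -> s g = t h -> A_linear act (quotient_op g h).
Proof.
move=> Hg Hh gh; apply: A_linear_comp; first apply: (A_linear_act HE).
  by case: Hsigma => _ /(_ g h gh)[].
apply: A_linear_comp; last exact: S_A_linear.
by have [] := Tb (restriction_mul Hg Hh gh).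
Qed.

Lemma quotient_op_near g h : H g -> H h -> s g = t h ->
  op_near (delta * M) (quotient_op g h) (T g).
Proof.
move=> Hg Hh gh e; have [TSh STh bS] := TS Hh.
rewrite -[X in T g X](STh e) distrC; apply: le_trans (Td Hg Hh gh _) _.
by rewrite -mulrA ler_wpM2l.
Qed.

Lemma integrand_linear g h : H g -> s g = t h ->
  linear_map (fun e => integrand g e h).
Proof.
move=> Hg gh; rewrite /integrand; have [->|wh] := eqVneq (w (s h)) 0.
  by split=> [x y|r x]; rewrite !scale0r ?addr0 ?scaler0.
have Hh : H h by split => //=; rewrite -gh; case: Hg.
apply: (linear_map_comp (linear_map_scale _ _)).
by have [] := quotient_op_A_linear Hg Hh gh.
Qed.

(** The delicate points are those with [w (s h0) = 0]: there [h0] is outside [H] and neither [T] nor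
    [S] is known to be continuous. Elsewhere the integrand is composed of continuous families. *)
Lemma integrand_cvg g0 h0 : H g0 -> s g0 = t h0 ->
  op_cvg (within [set p | H p.1 /\ s p.1 = t p.2] (nbhs (g0, h0)))
    (fun p e => integrand p.1 e p.2) (fun e => integrand g0 e h0).
Proof.
move=> Hg0 gh0; set D := [set p | _].
have ws_cvg D' : w (s p.2) @[p --> within D' (nbhs (g0, h0))] --> w (s h0).
  apply: cvg_within_filter.
  have wsc : w (s h) @[h --> h0] --> w (s h0) by apply: continuous_comp; [exact: sc|exact: wc].
  exact: (cvg_comp _ _ cvg_snd wsc).
have fst_cvg : p.1 @[p --> within D (nbhs (g0, h0))] --> within H (nbhs g0).
  move=> B nB; exists ([set x | H x -> B x], setT) => /=.
    by split => //; exact: filterT.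
  by move=> [g h] [/= HB _] [Hg _]; exact: HB.
have T1 : op_cvg (within D (nbhs (g0, h0))) (fun p => T p.1) (T g0).
  exact: op_cvg_reindex fst_cvg (Tc Hg0).
have DH p : D p -> w (s p.2) != 0 -> H p.2.
  by move=> [[/= Vs _] st] ws; split => //=; rewrite -st.
have nearD : \forall p \near within D (nbhs (g0, h0)), D p by exact: withinT.
(* Where the weight vanishes, [quotient_op] stays bounded by [K] near the point, and the weight
   tending to 0 suffices. *)
have [wh0|wh0] := eqVneq (w (s h0)) 0.
  have [_ [c0 /op_bound_pos[c c_gt0 bT0]]] := Tb Hg0.
  pose K := delta * M + (1 + c).
  have K0 : 0 < K by rewrite ltr_wpDl ?mulr_ge0 ?(ltW M_gt0)// addr_gt0.
  move=> eps eps0; near=> p => e.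
  have Dp : D p by near: p.
  rewrite /integrand wh0 scale0r subr0 normrZ.
  have [->|wp] := eqVneq (w (s p.2)) 0; first by rewrite normr0 mul0r mulr_ge0// ltW.
  have Hp2 := DH p Dp wp.
  have T1p : op_near 1 (T p.1) (T g0) by near: p; exact: T1.
  have bq := op_near_bound (quotient_op_near Dp.1 Hp2 Dp.2) (op_near_bound T1p bT0).
  have wp' : `|w (s p.2)| <= eps / K.
    rewrite -[X in `|X|]subr0 -wh0 distrC; near: p.
    by apply: (cvgr_dist_le _ _ (ws_cvg D)); rewrite divr_gt0.
  have -> : eps * `|e| = eps / K * (K * `|e|) by rewrite mulrA divfK// gt_eqF.
  by apply: ler_pM => //; exact: bq.
have Hh0 : H h0 by split => //=; rewrite -gh0; case: Hg0.
(* On [D2] the second arrow lies in [H]; since [w (s h0)] is positive, points of [D] close to the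
   limit belong to [D2]. *)
set D2 := D `&` [set p | w (s p.2) != 0].
have D2H p : D2 p -> H p.2 by move=> [Dp]; exact: DH.
suff C2 : op_cvg (within D2 (nbhs (g0, h0))) (fun p e => integrand p.1 e p.2) (fun e => integrand g0 e h0).
  move=> eps eps0; have near0 : \forall p \near within D (nbhs (g0, h0)), w (s p.2) != 0.
    have wpos : 0 < w (s h0) by rewrite lt_def wh0 w_ge0.
    have wpos' := cvgr_gt _ (ws_cvg D) _ wpos.
    by near=> p; rewrite gt_eqF//; near: p; exact: wpos'.
  have C2' : \forall p \near nbhs (g0, h0), D2 p ->
      op_near eps (fun e => integrand p.1 e p.2) (fun e => integrand g0 e h0) by exact: C2.
  have {}C2' : \forall p \near within D (nbhs (g0, h0)), D2 p ->
      op_near eps (fun e => integrand p.1 e p.2) (fun e => integrand g0 e h0) by exact: cvg_within.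
  near=> p; have Dp : D p by near: p.
  have wp : w (s p.2) != 0 by near: p.
  by move: (conj Dp wp); near: p.
have snd_cvg : p.2 @[p --> within D2 (nbhs (g0, h0))] --> within H (nbhs h0).
  move=> B nB; exists (setT, [set x | H x -> B x]) => /=.
    by split => //; exact: filterT.
  by move=> [g h] [/= _ HB] Dgh; apply: HB; exact: D2H Dgh.
have mul_cvg : m p.1 p.2 @[p --> within D2 (nbhs (g0, h0))] --> within H (nbhs (m g0 h0)).
  move=> B nB; have nB' : nbhs (m g0 h0) [set x | H x -> B x] by exact: nB.
  apply: filterS (near_gmul HG gh0 nB') => p Bp Dp; apply: Bp; first exact: Dp.1.2.
  by apply: restriction_mul; [exact: Dp.1.1|exact: D2H|exact: Dp.1.2].
have sigma_cvg : sigma p.1 p.2 @[p --> within D2 (nbhs (g0, h0))] --> sigma g0 h0.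
  have [/subspace_continuousP/(_ (g0, h0) gh0) sgc _ _ _] := Hsigma.
  move=> B nB.
  have nB' : \forall p \near nbhs (g0, h0), composable Gd p -> B (sigma p.1 p.2) by exact: sgc.
  by apply: filterS nB' => p Bp Dp; apply: Bp; exact: Dp.1.2.
have Hgh0 := restriction_mul Hg0 Hh0 gh0.
have [aT [cT bT]] := Tb Hgh0.
have [TSh STh bS] := TS Hh0.
have S_cvg : op_cvg (within D2 (nbhs (g0, h0))) (fun p => S p.2) (S h0).
  apply: (@op_cvg_inv _ _ _ _ _ (fun p => T p.2) _ (T h0) _ M) => //.
    apply: (@filterS _ _ _ D2); last exact: withinT.
    by move=> p /D2H Hp; have [? ? ?] := TS Hp; split => //; exact: T_linear.
  exact: op_cvg_reindex snd_cvg (Tc Hh0).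
have M0 := ltW M_gt0.
have [cT' cT'0 bT'] := op_bound_pos bT.
have TS_cvg : op_cvg (within D2 (nbhs (g0, h0))) (fun p => T (m p.1 p.2) \o S p.2) (T (m g0 h0) \o S h0).
  apply: op_cvg_comp bT' bS _ S_cvg; first exact: aT.1.
  exact: op_cvg_reindex mul_cvg (Tc Hgh0).
have q_cvg : op_cvg (within D2 (nbhs (g0, h0))) (fun p => quotient_op p.1 p.2) (quotient_op g0 h0).
  apply: op_cvg_comp (act_bound HE _) (op_bound_comp bT' bS (ltW cT'0)) _ TS_cvg.
    exact: (act_linear HE).
  exact: (act_cvg HE).
have bq := op_bound_comp (act_bound HE (sigma g0 h0)) (op_bound_comp bT' bS (ltW cT'0)) (normr_ge0 _).
apply: (@op_cvg_comp _ _ _ _ _ (fun p e => w (s p.2) *: e) (fun e => w (s h0) *: e) `|w (s h0)|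
  (fun p => quotient_op p.1 p.2) (quotient_op g0 h0) _ _ _ bq _ q_cvg).
- exact: linear_map_scale.
- exact: op_bound_scale.
- exact: op_cvg_scale (ws_cvg D2).
Unshelve. all: by end_near. Qed.

Lemma integrand_bound g h : H g -> s g = t h -> exists c, op_bound (fun e => integrand g e h) c.
Proof.
move=> Hg gh; have [wh|wh] := eqVneq (w (s h)) 0.
  by exists 0 => e; rewrite /integrand wh scale0r normr0 mul0r.
have Hh : H h by split => //=; rewrite -gh; case: Hg.
have [_ [c bT]] := Tb Hg.
exists (`|w (s h)| * (delta * M + c)).
apply: (op_bound_comp (op_bound_scale _) _ (normr_ge0 _)).
exact: op_near_bound (quotient_op_near Hg Hh gh) bT.
Qed.

Lemma integrand_cutoff g h e : H g -> s g = t h -> chi h *: integrand g e h = integrand g e h.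
Proof.
move=> [Vg _] gh; rewrite /integrand scalerA weight_cutoff//=.
by rewrite -gh.
Qed.

(** The operators [B i] and functions [psi i] are independent of [g]. One approximation therefore
    gives both the existence of the integral and, since [g] enters only through the fibre, the
    continuity of the average. *)
Lemma integrand_approx g0 eps : H g0 -> 0 < eps ->
  exists (l : seq G) (psi : G -> G -> R) (B : G -> E -> E),
  [/\ forall i, continuous (psi i), forall i, exists c, op_bound (B i) c &
    \forall g \near within H (nbhs g0), forall h, s g = t h -> forall e,
      `|integrand g e h - \sum_(i <- l) (chi h * psi i h) *: B i e| <= chi h * (eps * `|e|)].
Proof.
(* One third pays for moving from (g, h) to (g0, h0), one for the partition of unity at h0, one for
   the variation of the [psi i]. *)
move=> Hg0 eps0; set e1 := eps / 3; have e10 : 0 < e1 by rewrite divr_gt0.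
pose Q' := closure [set h | chi h != 0].
have cQ' : compact Q' by case: chic.
pose Z := Q' `&` fiber Gd (s g0).
have cZ : compact Z by apply: compact_closedI => //; exact: (closed_fiber HG).
pose U h := [set h' | s g0 = t h' -> op_near e1 (fun e => integrand g0 e h') (fun e => integrand g0 e h)].
have ZU h : Z h -> nbhs h (U h).
  move=> [_ th]; have := integrand_cvg Hg0 (esym th) e10.
  rewrite /within /= => -[[A1 A2] /= [nA1 nA2] A12].
  apply: filterS nA2 => h' A2h' gh'; apply: (A12 (g0, h')) => //=.
  by split => //; exact: nbhs_singleton nA1.
have [l [psi [lZ psic psi1 _ psiU]]] := partition_of_unity R (hausdorff_arrows HG) (locally_compact_arrows HG) cZ ZU.
(* The value 0 off the fibre makes every [B i] bounded; indices in [l] lie on the fibre and never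
   meet it. *)
pose B i e := if `[< s g0 = t i >] then integrand g0 e i else 0.
have Bb i : exists c, op_bound (B i) c.
  rewrite /B; case: asboolP => [gi|_]; first exact: integrand_bound.
  by exists 0 => e; rewrite normr0 mul0r.
exists l, psi, B; split => //; first by move=> i; exact: (psic i).1.
have lB i e : i \in l -> B i e = integrand g0 e i.
  by move=> /lZ[_ ti]; rewrite /B; case: asboolP => // /(_ (esym ti)).
have at0 h0 : Z h0 -> op_near e1 (fun e => integrand g0 e h0) (fun e => \sum_(i <- l) psi i h0 *: B i e).
  move=> Zh0 e; rewrite -[integrand g0 e h0]scale1r -(psi1 h0 Zh0) scaler_suml -sumrB.
  apply: le_trans (ler_norm_sum _ _ _) _.
  rewrite -[leRHS]mul1r -(psi1 h0 Zh0) mulr_suml big_seq [leRHS]big_seq.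
  apply: ler_sum => i il; rewrite -scalerBr normrZ ger0_norm ?(psic i).2//.
  have [->|pi] := eqVneq (psi i h0) 0; first by rewrite !mul0r.
  rewrite ler_wpM2l ?(psic i).2// lB//.
  by apply: (psiU i h0 il pi); rewrite Zh0.2.
have : \forall g \near nbhs g0, forall h, Q' h -> H g -> s g = t h ->
    op_near eps (fun e => integrand g e h) (fun e => \sum_(i <- l) psi i h *: B i e).
  have /compact_near_coveringP cov := cQ'.
  apply: (cov _ _ (fun g h => H g -> s g = t h -> op_near eps _ _)) => h0 Q'h0.
  (* If [h0] is off the fibre, separating [s g0] from [t h0] leaves no composable pairs nearby. *)
  have [gh0|gh0] := pselect (s g0 = t h0); last first.
    have [A1 [A2 [nA1 nA2 A12]]] := hausdorff_separation (hausdorff_units HG) gh0.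
    exists (t @^-1` A2, s @^-1` A1) => /=; first by split; [exact: tc|exact: sc].
    by move=> [h g] /= [A2h A1g] _ gh; exfalso; apply: (A12 (s g)) => //; rewrite gh.
  have Zh0 : Z h0 by split.
  have C1 := integrand_cvg Hg0 gh0 e10.
  have C2 : op_cvg (nbhs h0) (fun h e => \sum_(i <- l) psi i h *: B i e) (fun e => \sum_(i <- l) psi i h0 *: B i e).
    by apply: op_cvg_sum => // i; exact: (psic i).1.
  move: C1; rewrite /within /= => -[[A1 A2] /= [nA1 nA2] A12].
  exists (A2 `&` [set h | op_near e1 (fun e => \sum_(i <- l) psi i h *: B i e) (fun e => \sum_(i <- l) psi i h0 *: B i e)], A1) => /=.
    by split => //; apply: filterI => //; exact: C2.
  move=> [h g] /= [[A2h C2h] A1g] Hg gh.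
  have -> : eps = e1 + (e1 + e1) by rewrite /e1; field.
  apply: op_near_trans (A12 (g, h) (conj A1g A2h) (conj Hg gh)) _.
  exact: op_near_trans (at0 _ Zh0) (op_near_sym C2h).
rewrite /within /=; apply: filterS => g Hnear Hg h gh e.
have -> : \sum_(i <- l) (chi h * psi i h) *: B i e = chi h *: \sum_(i <- l) psi i h *: B i e.
  by rewrite scaler_sumr; apply: eq_bigr => i _; rewrite scalerA.
rewrite -(integrand_cutoff e Hg gh) -scalerBr normrZ ger0_norm//.
have [->|chih] := eqVneq (chi h) 0; first by rewrite !mul0r.
by rewrite ler_wpM2l// Hnear//; exact: subset_closure.
Qed.

Lemma Cc_chiM f : continuous f -> Cc (fun h => chi h * f h).
Proof. by move=> fc; exact: CcM. Qed.

Definition average_integral g e : E := xget 0 [set b | Cc_integral (s g) (integrand g e) b].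

Lemma average_integralP g e : H g -> Cc_integral (s g) (integrand g e) (average_integral g e).
Proof.
move=> Hg; suff [b] : exists b, Cc_integral (s g) (integrand g e) b by exact: xgetI.
apply: is_integral_exists; first exact: Cc_positive_functional.
move=> eps eps0.
have K0 : 0 <= I (s g) chi.
  rewrite -(pf0 (fiber_positive_functional HG (s g))).
  by apply: (pf_le (Cc_positive_functional (s g))) => //; exact: Cc0.
(* [K] dominates the integral of [chi] times the norm of [e]; the added ones keep it positive. *)
pose K := (I (s g) chi + 1) * (`|e| + 1).
have Kpos : 0 < K by rewrite mulr_gt0// ltr_wpDl.
have [|l [psi [B [psic Bb Hnear]]]] := @integrand_approx g (eps / K) Hg; first by rewrite divr_gt0.
have Happ := nbhs_singleton Hnear Hg.
have [Dc Ic] := pfZ (Cc_positive_functional (s g)) (eps / K * `|e|) chic.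
exists (fun h => \sum_(i <- l) (chi h * psi i h) *: B i e),
  (\sum_(i <- l) I (s g) (fun h => chi h * psi i h) *: B i e),
  (fun h => eps / K * `|e| * chi h); split => //.
- by apply: (@elementary_sum _ _ _ _ _ _ l (fun i h => chi h * psi i h) (fun i => B i e)) => i; exact: Cc_chiM.
- by move=> h th; rewrite mulrC; apply: Happ.
- rewrite Ic -[leRHS](divfK (lt0r_neq0 Kpos)) -!mulrA ler_wpM2l ?(ltW eps0)//.
  rewrite ler_wpM2l ?invr_ge0 ?(ltW Kpos)// /K mulrC.
  by apply: ler_pM => //; rewrite lerDl.
Qed.

Definition average g e : E := (mass (s g))^-1 *: average_integral g e.

Lemma massK g e : H g -> mass (s g) *: average g e = average_integral g e.
Proof.
by move=> [Vg _]; rewrite /average scalerA divff ?scale1r// gt_eqF// mass_gt0.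
Qed.

Lemma average_integral_A_linear g : H g -> A_linear act (average_integral g).
Proof.
move=> Hg; have DI := Cc_positive_functional (s g).
have lin h : fiber Gd (s g) h -> w (s h) != 0 -> A_linear act (quotient_op g h).
  move=> th wh; apply: quotient_op_A_linear => //.
  by split => //=; rewrite (th : t h = s g); case: Hg.
split; first split.
- move=> x y; apply: (is_integral_unique DI (average_integralP (x + y) Hg)).
  apply: eq_is_integral (is_integralD DI (average_integralP x Hg) (average_integralP y Hg)) => h th.
  by rewrite -(integrand_linear Hg (esym th)).1.
- move=> r x; apply: (is_integral_unique DI (average_integralP (r *: x) Hg)).
  have := is_integral_lin DI (linear_map_scale E r).1 (linear_map_scale E r).2 (op_bound_scale r) (average_integralP x Hg).
  apply: eq_is_integral => h th /=.
  by rewrite -(integrand_linear Hg (esym th)).2.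
- move=> a x; apply: (is_integral_unique DI (average_integralP (act a x) Hg)).
  have := is_integral_lin DI (act_linear HE a).1 (act_linear HE a).2 (act_bound HE a) (average_integralP x Hg).
  apply: eq_is_integral => h th /=; rewrite /integrand.
  have [->|wh] := eqVneq (w (s h)) 0; first by rewrite !scale0r (linear_map0 (act_linear HE a)).
  by rewrite (act_linear HE a).2 (lin h th wh).2.
Qed.

Lemma average_A_linear g : H g -> A_linear act (average g).
Proof.
move=> Hg; have aJ := average_integral_A_linear Hg.
split; first exact: linear_map_comp (linear_map_scale _ _) aJ.1.
by move=> a e; rewrite /average aJ.2 (act_linear HE a).2.
Qed.

Lemma integral_norm_weight y f b c : V y -> L1_integral y f b ->
  (forall h, t h = y -> `|f h| <= c * w (s h)) -> `|b| <= c * mass y.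
Proof.
move=> Vy fb H; have DI := fiber_positive_functional HG y.
have [Dc Ic] := pfZ DI c (Cc_fiber_integrable HG y Cc_weight).
rewrite /mass -Ic; apply: (is_integral_norm DI fb Dc) => h th.
by rewrite weight_cutoff /= ?(th : t h = y)//; exact: H.
Qed.

Lemma weight_integral y b : V y -> L1_integral y (fun h => w (s h) *: b) (mass y *: b).
Proof.
move=> Vy; have DI := fiber_positive_functional HG y.
have := is_integral_scale DI b (Cc_fiber_integrable HG y Cc_weight).
apply: eq_is_integral => h th.
by rewrite weight_cutoff //= (th : t h = y).
Qed.

Lemma average_near g : H g -> op_near (delta * M) (average g) (T g).
Proof.
move=> Hg e; have [Vg _] := Hg; have Ng := mass_gt0 Vg.
rewrite -(ler_pM2l Ng) -{1}(gtr0_norm Ng) -normrZ scalerBr massK// mulrC.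
have DI := fiber_positive_functional HG (s g).
apply: (integral_norm_weight Vg (is_integralB DI (Cc_L1_integral (average_integralP e Hg)) (weight_integral (T g e) Vg))).
move=> h th; rewrite /integrand -scalerBr normrZ ger0_norm// mulrC.
have [->|wh] := eqVneq (w (s h)) 0; first by rewrite !mulr0.
rewrite ler_wpM2r//; apply: quotient_op_near => //.
by split => //=; rewrite th.
Qed.

Lemma average_bounded : bounded_family act H average.
Proof.
move=> g Hg; split; first exact: average_A_linear.
have [_ [c bT]] := Tb Hg; exists (delta * M + c).
exact: op_near_bound (average_near Hg) bT.
Qed.

Lemma average_integral_approx g l psi B eps : H g -> (forall i, continuous (psi i)) -> 0 <= eps ->
  (forall h, s g = t h -> forall e, `|integrand g e h - \sum_(i <- l) (chi h * psi i h) *: B i e|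
     <= chi h * (eps * `|e|)) ->
  op_near (eps * I (s g) chi) (average_integral g)
    (fun e => \sum_(i <- (l : seq G)) I (s g) (fun h => chi h * psi i h) *: (B : G -> E -> E) i e).
Proof.
move=> Hg psic eps0 Happ e; have DI := Cc_positive_functional (s g).
have [Dc Ic] := pfZ DI (eps * `|e|) chic.
have el := @elementary_sum _ _ _ [set f | Cc f] (I (s g)) _ l (fun i h => chi h * psi i h) (fun i => B i e)
  (fun i => Cc_chiM (psic i)).
have := is_integralB DI (average_integralP e Hg) (is_integral_elementary DI el).
rewrite mulrAC -Ic => /(is_integral_norm DI)/(_ Dc); apply => h th.
by rewrite mulrC; exact: Happ.
Qed.

(** Near [g0] the integral is uniformly close to a finite sum whose coefficients are fibre integrals
    of fixed functions in [Cc], and these vary continuously with the unit. *)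
Lemma average_integral_continuous : continuous_family H average_integral.
Proof.
move=> g0 Hg0 eps eps0.
pose C := `|I (s g0) chi| + 1; have C0 : 0 < C by rewrite ltr_pwDr.
pose e1 := eps / 3 / C; have e10 : 0 < e1 by rewrite !divr_gt0.
have e30 : 0 < eps / 3 by rewrite divr_gt0.
have Is_cvg f : Cc f -> I (s g) f @[g --> within H (nbhs g0)] --> I (s g0) f.
  move=> cf; apply: cvg_within_filter.
  have If : I y f @[y --> s g0] --> I (s g0) f by exact: fiber_integral_continuous.
  have sg0 : s g @[g --> g0] --> s g0 by exact: sc.
  exact: (cvg_comp _ _ sg0 If).
have [l [psi [B [psic Bb Happ]]]] := integrand_approx Hg0 e10.
pose L g e := \sum_(i <- l) I (s g) (fun h => chi h * psi i h) *: B i e.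
have L_cvg : op_cvg (within H (nbhs g0)) L (L g0).
  by apply: op_cvg_sum => // i; apply: Is_cvg; exact: Cc_chiM.
have JL g : H g -> `|I (s g) chi| <= C ->
    (forall h, s g = t h -> forall e, `|integrand g e h - \sum_(i <- l) (chi h * psi i h) *: B i e|
      <= chi h * (e1 * `|e|)) -> op_near (eps / 3) (average_integral g) (L g).
  move=> Hg IC Hgapp; apply: op_near_le (average_integral_approx Hg psic (ltW e10) Hgapp).
  have -> : eps / 3 = e1 * C by rewrite /e1 divfK// gt_eqF.
  by rewrite ler_wpM2l ?(ltW e10)//; exact: le_trans (ler_norm _) IC.
have J0 : op_near (eps / 3) (average_integral g0) (L g0).
  by apply: JL => //; [rewrite lerDl|exact: nbhs_singleton Happ Hg0].
near=> g.
have Hg : H g by near: g; exact: withinT.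
have -> : eps = eps / 3 + (eps / 3 + eps / 3) by field.
apply: op_near_trans (JL _ Hg _ _) _.
- have : `|I (s g0) chi - I (s g) chi| <= 1.
    by near: g; exact: (cvgr_dist_le _ _ (Is_cvg _ chic) _ ltr01).
  move=> h1; rewrite -[I (s g) chi](subKr (I (s g0) chi)).
  by apply: le_trans (ler_normB _ _) _; rewrite lerD2l.
- by near: g; exact: Happ.
apply: op_near_trans (op_near_sym J0).
by near: g; exact: L_cvg.
Unshelve. all: by end_near. Qed.

Lemma average_continuous : continuous_family H average.
Proof.
move=> g Hg; have [_ [c bA]] := average_bounded Hg.
have [Vg _] := Hg; have Ng := mass_gt0 Vg.
have bJ : op_bound (average_integral g) (mass (s g) * c).
  move=> e; rewrite -massK// normrZ gtr0_norm// -mulrA ler_wpM2l//; exact: ltW.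
apply: (@op_cvg_comp _ _ _ _ _ (fun k e => (mass (s k))^-1 *: e) (fun e => (mass (s g))^-1 *: e)
  `|(mass (s g))^-1| average_integral _ _ _ _ bJ).
- exact: linear_map_scale.
- exact: op_bound_scale.
- apply: op_cvg_scale; apply: cvgV; first by rewrite gt_eqF.
  apply: cvg_within_filter; have mc : mass y @[y --> s g] --> mass (s g) by exact: mass_continuous.
  have sg : s k @[k --> g] --> s g by exact: sc.
  exact: (cvg_comp _ _ sg mc).
- exact: average_integral_continuous.
Qed.

(** The inner [T (m h k)] cancels against its inverse, and the cocycle identity matches the
    remaining central factors. No smallness of the defect enters. *)
Lemma quotient_op_mul g h k : H g -> H h -> H k -> s g = t h -> s h = t k ->
  act (sigma g h) \o quotient_op (m g h) k =1 quotient_op g (m h k) \o quotient_op h k.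
Proof.
move=> Hg Hh Hk gh hk e.
have Hhk := restriction_mul Hh Hk hk.
have [_ sc_ _ cocycle] := Hsigma.
have ghk : s g = t (m h k) by rewrite (tgt_mul HG).
have lin_hk : A_linear act (act (sigma h k)) by apply: (A_linear_act HE); exact: (sc_ _ _ hk).2.
have [TShk _ _] := TS Hhk.
have [aT _] := Tb (restriction_mul Hg Hhk ghk).
have aS := S_A_linear Hhk.
rewrite /quotient_op /= aS.2 TShk aT.2 (gmulA HG)//.
rewrite -!(actM HE) cocycle//; congr act.
by rewrite (sc_ _ _ hk).2.
Qed.

(** Put a_k = [quotient_op g (m h k)] and b_k = [quotient_op h k]. Under the weighted mean,
    [quotient_op_mul] makes the defect the mean of a_k b_k minus the product of means, that is, the
    mean of (a_k - a)(b_k - b) with a, b the averages at [g] and [h]. Each factor has size at most 2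
    delta M. *)
Lemma average_defect : defect_le Gd sigma act H average (4 * (delta * M) ^+ 2).
Proof.
move=> g h Hg Hh gh e /=.
have Hgh := restriction_mul Hg Hh gh.
have sgh : s (m g h) = s h by rewrite (src_mul HG).
have [Vsh Vth] := Hh; pose y := s h; have Nh := mass_gt0 Vsh.
have Ngh : mass (s g) = mass (s h) by rewrite gh (mass_invariant Hh).
have DI := fiber_positive_functional HG y.
set b := delta * M; have b0 : 0 <= b by rewrite mulr_ge0// ltW.
have lA := (average_A_linear Hg).1.
have [_ [cA bA]] := average_bounded Hg.
pose e' := average h e.
(* With a, b, a_k, b_k as above and the weight understood, [I1] to [I4] integrate a_k b_k, a_k b, a
   b_k and a b. Invariance of the measure under [h] is used in [I2] only. *)
have I1 : L1_integral y (fun k => act (sigma g h) (integrand (m g h) e k))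
    (act (sigma g h) (average_integral (m g h) e)).
  rewrite /y -sgh; have := Cc_L1_integral (average_integralP e Hgh).
  rewrite sgh => fb.
  exact: (is_integral_lin DI (act_linear HE _).1 (act_linear HE _).2 (act_bound HE _) fb).
have I2 : L1_integral y (integrand g e' \o m h) (average_integral g e').
  by apply: translate_integral; rewrite -gh; exact: average_integralP.
have I3 : L1_integral y (fun k => average g (integrand h e k)) (average g (average_integral h e)).
  exact: (is_integral_lin DI lA.1 lA.2 bA (Cc_L1_integral (average_integralP e Hh))).
have I4 := weight_integral (average g e') Vsh.
have := is_integralB DI (is_integralD DI (is_integralB DI I1 I2) I4) I3.
set total := (X in is_integral _ _ _ _ X).
have -> : total = mass y *: (act (sigma g h) (average (m g h) e) - average g (average h e)).
  rewrite /total -!massK// sgh Ngh (act_linear HE _).2 lA.2 scalerBr -/e'.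
  by rewrite subrK.
move=> Itot; rewrite distrC -(ler_pM2l Nh) -{1}(gtr0_norm Nh) -normrZ [leRHS]mulrC.
apply: (integral_norm_weight Vsh Itot) => k tk /=.
have hk : s h = t k by rewrite tk.
have [wk|wk] := eqVneq (w (s k)) 0.
  rewrite /integrand (src_mul HG)// wk !scale0r (linear_map0 (act_linear HE _)) (linear_map0 lA).
  by rewrite !subr0 addr0 normr0 mulr0.
have Hk : H k by split => //=; rewrite tk.
have Hhk := restriction_mul Hh Hk hk.
have ghk : s g = t (m h k) by rewrite (tgt_mul HG).
(* The quotient operators and the average both lie within [b] of [T g], whence [b + b]. *)
have near2 k' : H k' -> s g = t k' -> op_near (b + b) (quotient_op g k') (average g).
  move=> Hk' gk'; apply: op_near_trans (quotient_op_near Hg Hk' gk') _.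
  exact: op_near_sym (average_near Hg).
have near3 : op_near (b + b) (quotient_op h k) (average h).
  apply: op_near_trans (quotient_op_near Hh Hk hk) _.
  exact: op_near_sym (average_near Hh).
have lq := (quotient_op_A_linear Hg Hhk ghk).1.
rewrite /integrand (src_mul HG)// (act_linear HE _).2 lA.2.
have := quotient_op_mul Hg Hh Hk gh hk e; rewrite /= => ->.
rewrite -!scalerBr -scalerDr -scalerBr normrZ ger0_norm// [leRHS]mulrC ler_wpM2l//.
set d := quotient_op h k e.
have -> : quotient_op g (m h k) d - quotient_op g (m h k) e' + average g e' - average g d =
    quotient_op g (m h k) (d - e') - average g (d - e').
  by rewrite (linear_mapB d e' lq) (linear_mapB d e' lA) opprB -!addrA.
apply: le_trans (near2 _ Hhk ghk _) _.
have -> : 4 * b ^+ 2 * `|e| = (b + b) * ((b + b) * `|e|) by rewrite expr2; ring.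
by rewrite ler_wpM2l ?addr_ge0//; exact: near3.
Qed.

End Averaging.

(** * Invertibility under perturbation, and limits of operators *)

Section Perturbation.
Variables (R : realType) (E : completeNormedModType R).
Implicit Types (T S : E -> E).

Lemma norm_le_eps_eq0 (a : E) (C : R) : (forall eps : R, 0 < eps -> `|a| <= eps * C) -> a = 0.
Proof.
move=> H; apply/eqP; rewrite -normr_eq0 eq_le normr_ge0 andbT.
apply/ler_addgt0Pr => e e0; rewrite add0r.
have C0 : 0 < `|C| + 1 by rewrite ltr_pwDr.
apply: le_trans (H (e / (`|C| + 1)) (divr_gt0 e0 C0)) _.
rewrite -[leRHS](divfK (lt0r_neq0 C0)) ler_wpM2l ?divr_ge0 ?(ltW e0) ?(ltW C0)//.
by apply: le_trans (ler_norm _) _; rewrite lerDl.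
Qed.

Lemma half_exp_gt0 n : 0 < 2^-1 ^+ n :> R.
Proof. by rewrite exprn_gt0// invr_gt0. Qed.

Lemma half_exp_small (C eps : R) : 0 < eps -> \forall n \near \oo, C * 2^-1 ^+ n < eps.
Proof.
move=> eps0.
have h : `|2^-1 : R| < 1 by rewrite gtr0_norm ?invr_gt0// invf_lt1// ltr1n.
have c : C * 2^-1 ^+ n @[n --> \oo] --> C * (0 : R).
  by apply: cvgM; [exact: cvg_cst|exact: cvg_expr].
rewrite mulr0 in c; exact: cvgr_lt c _ eps0.
Qed.

Lemma geometric_limit (v : nat -> E) (C : R) :
  (forall n, `|v n.+1 - v n| <= C * 2^-1 ^+ n) ->
  exists l, forall n, `|l - v n| <= 2 * C * 2^-1 ^+ n.
Proof.
move=> H.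
have C0 : 0 <= C by have := H 0; rewrite expr0 mulr1; exact: le_trans.
(* The subtracted term is the tail of the geometric series; it makes the induction on [k] close. *)
have vd n k : `|v (n + k)%N - v n| <= 2 * C * (2^-1 ^+ n - 2^-1 ^+ (n + k)).
  elim: k => [|k IH]; first by rewrite addn0 !subrr normr0 mulr0.
  rewrite addnS -(subrK (v (n + k)%N) (v (n + k).+1)) -addrA.
  apply: le_trans (ler_normD _ _) _; apply: le_trans (lerD (H _) IH) _.
  by rewrite exprS; lra.
have vd' n k : `|v (n + k)%N - v n| <= 2 * C * 2^-1 ^+ n.
  apply: le_trans (vd n k) _; rewrite ler_wpM2l ?mulr_ge0//.
  by rewrite lerBlDr lerDl ltW// half_exp_gt0.
have cv : cvgn v.
  apply/cauchy_cvgP/cauchy_exP => e e0.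
  have [N HN] := filter_ex (half_exp_small (2 * C) e0).
  exists (v N); suff : \forall n \near \oo, ball (v N) e (v n) by [].
  near=> n; rewrite -ball_normE /= distrC; apply: le_lt_trans HN.
  have Nn : (N <= n)%N by near: n; exact: nbhs_infty_ge.
  by rewrite -(subnKC Nn).
exists (limn v) => n.
have cvn : (fun k => `|v (k + n)%N - v n|) @ \oo --> `|limn v - v n|.
  apply: cvg_norm; apply: cvgB; last exact: cvg_cst.
  by rewrite cvg_shiftn.
apply: (cvgr_to_le cvn).
by apply: nearW => k; rewrite addnC.
Unshelve. all: by end_near. Qed.

(** Closeness to an invertible operator bounds [T] below by 1/(2M), which gives injectivity and the
    bound on the inverse; surjectivity comes from a Neumann series. *)
Lemma inverse_perturbation T T0 S0 M c : linear_map T -> (exists d, op_bound T d) ->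
  0 < M -> cancel T0 S0 -> cancel S0 T0 -> linear_map T0 -> op_bound S0 M ->
  op_near c T T0 -> c * M <= 2^-1 ->
  exists S, [/\ cancel T S, cancel S T & op_bound S (2 * M)].
Proof.
move=> lT [d bT] M0 TS ST lT0 bS TT0 cM.
have lS := linear_map_inv lT0 TS ST.
have below e : `|e| <= 2 * M * `|T e|.
  have : `|e| <= M * (`|T e| + c * `|e|).
    rewrite -{1}(TS e); apply: le_trans (bS _) _; rewrite ler_wpM2l ?(ltW M0)//.
    rewrite -[T0 e](subKr (T e)); apply: le_trans (ler_normB _ _) _.
    by rewrite lerD2l.
  have : c * M * `|e| <= 2^-1 * `|e| by rewrite ler_wpM2r.
  lra.
have surj f : exists x, T x = f.
  (* [r n] is the residual of the approximate solution [x n]. Correcting by [S0 (r n)] leaves (T0 -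
     T) (S0 (r n)), at most half as large since c M <= 1/2. *)
  pose r := fix r n := if n is n'.+1 then r n' - T (S0 (r n')) else f.
  pose x := fix x n := if n is n'.+1 then x n' + S0 (r n') else 0.
  have rE n : r n = f - T (x n).
    elim: n => [|n IH] /=; first by rewrite linear_map0// subr0.
    by rewrite lT.1 opprD addrA -IH.
  have rn n : `|r n| <= `|f| * 2^-1 ^+ n.
    elim: n => [|n IH] /=; first by rewrite expr0 mulr1.
    rewrite -{1}(ST (r n)) distrC; apply: le_trans (TT0 _) _.
    have [c0|c0] := leP 0 c; last first.
      apply: (@le_trans _ _ 0); first by rewrite mulr_le0_ge0// ltW.
      by rewrite mulr_ge0// ltW// half_exp_gt0.
    apply: (@le_trans _ _ (c * (M * `|r n|))); first by rewrite ler_wpM2l.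
    rewrite mulrA exprS mulrCA; apply: ler_pM => //.
    by rewrite mulr_ge0// ltW.
  have [n|l Hl] := @geometric_limit x (M * `|f|).
    rewrite /= addrC addKr; apply: le_trans (bS _) _.
    by rewrite -mulrA ler_wpM2l ?(ltW M0).
  have [{}d d0 {}bT] := op_bound_pos bT.
  exists l; apply/eqP; rewrite -subr_eq0; apply/eqP.
  apply: (@norm_le_eps_eq0 _ 1) => eps eps0; rewrite mulr1.
  pose K := d * (2 * (M * `|f|)) + `|f|.
  have [n Kn] := filter_ex (half_exp_small K eps0).
  apply: le_trans (ltW Kn).
  have -> : T l - f = T (l - x n) - r n by rewrite linear_mapB// rE opprB addrA subrK.
  apply: le_trans (ler_normB _ _) _; rewrite /K mulrDl lerD//.
  by apply: le_trans (bT _) _; rewrite -mulrA ler_wpM2l ?(ltW d0).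
have [S HS] := choice surj.
exists S; split => [e|e|e] //.
- apply/eqP; rewrite -subr_eq0; apply/eqP.
  have := below (S (T e) - e); rewrite linear_mapB// HS subrr normr0 mulr0 normr_le0.
  by move/eqP.
- by rewrite -{2}(HS e).
Qed.

End Perturbation.

Section Limits.
Variables (R : realType) (A E : completeNormedModType R) (act : A -> E -> E).

Lemma op_cvg_eq (I : Type) (F : set_system I) (PF : ProperFilter F)
    (T S : I -> E -> E) (T0 S0 : E -> E) :
  op_cvg F T T0 -> op_cvg F S S0 ->
  (forall eps : R, 0 < eps -> \forall i \near F, op_near eps (T i) (S i)) -> T0 =1 S0.
Proof.
move=> TT0 SS0 TS e; apply/eqP; rewrite -subr_eq0; apply/eqP.
apply: (@norm_le_eps_eq0 _ _ _ (3 * `|e|)) => eps eps0.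
have [i [[h1 h2] h3]] := filter_ex (filterI (filterI (TT0 _ eps0) (SS0 _ eps0)) (TS _ eps0)).
have := op_near_trans (op_near_sym h1) (op_near_trans h3 h2) e.
by move=> /le_trans; apply; rewrite le_eqVlt; apply/orP; left; apply/eqP; ring.
Qed.

Lemma op_cvg_pt (I : Type) (F : set_system I) (FF : Filter F) (T : I -> E -> E) (T0 : E -> E) e :
  op_cvg F T T0 -> T i e @[i --> F] --> T0 e.
Proof.
move=> TT0; apply/cvgrPdist_le => eps eps0.
have e0 : 0 < eps / (`|e| + 1) by rewrite divr_gt0// ltr_wpDl.
near=> i; rewrite distrC.
have h : op_near (eps / (`|e| + 1)) (T i) T0 by near: i; exact: TT0.
apply: le_trans (h e) _; rewrite -[leRHS](divfK (lt0r_neq0 (ltr_wpDl (normr_ge0 e) ltr01))).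
by rewrite ler_wpM2l ?(ltW e0)// lerDl.
Unshelve. all: by end_near. Qed.

Lemma A_linear_limit (I : Type) (F : set_system I) (PF : ProperFilter F)
    (T : I -> E -> E) (T0 : E -> E) :
  (forall a, linear_map (act a)) -> (forall a, exists c, op_bound (act a) c) ->
  (forall i, A_linear act (T i)) -> op_cvg F T T0 -> A_linear act T0.
Proof.
move=> lact bact aT TT0.
have pt e : T i e @[i --> F] --> T0 e by exact: op_cvg_pt.
have hE := @norm_hausdorff R E.
split; first split.
- move=> x y; have := pt (x + y).
  rewrite (_ : (fun i => T i (x + y)) = fun i => T i x + T i y) => [h|].
    exact: (@cvg_unique _ hE _ _ (T0 (x + y)) (T0 x + T0 y) h (cvgD (pt x) (pt y))).
  by apply/funext => i; rewrite (aT i).1.1.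
- move=> r x; have := pt (r *: x).
  rewrite (_ : (fun i => T i (r *: x)) = fun i => r *: T i x) => [h|].
    exact: (@cvg_unique _ hE _ _ (T0 (r *: x)) (r *: T0 x) h (cvgZr (pt x))).
  by apply/funext => i; rewrite (aT i).1.2.
- move=> a x; have := pt (act a x).
  rewrite (_ : (fun i => T i (act a x)) = fun i => act a (T i x)) => [h|]; last first.
    by apply/funext => i; rewrite (aT i).2.
  have [c bc] := bact a.
  suff aTT0 : op_cvg F (fun i => act a \o T i) (act a \o T0).
    have h2 : act a (T i x) @[i --> F] --> act a (T0 x) by exact: (op_cvg_pt (e := x) _ aTT0).
    exact: (@cvg_unique _ hE _ _ (T0 (act a x)) (act a (T0 x)) h h2).
  move=> eps eps0; have [d d0 bd] := op_bound_pos bc.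
  have ed0 : 0 < eps / d by rewrite divr_gt0.
  near=> i => e /=; have hi : op_near (eps / d) (T i) T0 by near: i; exact: TT0.
  rewrite -linear_mapB//; apply: le_trans (bd _) _.
  have -> : eps * `|e| = d * (eps / d * `|e|) by rewrite mulrA [d * _]mulrC divfK// gt_eqF.
  by rewrite ler_wpM2l ?(ltW d0).
Unshelve. all: by end_near. Qed.

End Limits.

(** * Rectification by iterated averaging *)

Section Rectification.
Variables (R : realType) (X : topologicalType) (G : ptopologicalType).
Variables (Gd : groupoid X G) (mu : X -> {measure set (Borel G) -> \bar R}).
Hypothesis HG : locally_compact_groupoid Gd mu.
Variables (A : completeNormedModType R) (amul : A -> A -> A) (aone : A).
Variables (sigma : G -> G -> A) (E : completeNormedModType R) (act : A -> E -> E).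
Hypotheses (Hsigma : multiplier Gd amul aone sigma) (HE : banach_module amul aone act).
Variables (w : X -> R) (Q : set G).
Hypotheses (wc : continuous w) (w_ge0 : forall y, 0 <= w y) (cQ : compact Q).
Local Notation H := (restriction Gd [set y | w y != 0]).
Hypothesis HQ : H `<=` Q.

Variables (T0 S0 : G -> E -> E) (M delta : R).
Hypotheses (M_gt0 : 0 < M) (delta_ge0 : 0 <= delta) (deltaM : 32 * M ^+ 2 * delta <= 1).
Hypotheses (T0b : bounded_family act H T0) (T0c : continuous_family H T0).
Hypotheses (TS0 : inverse_family H T0 S0 M) (T0d : defect_le Gd sigma act H T0 delta).

Let perturbed_inverse T : bounded_family act H T ->
  (forall g, H g -> op_near (4 * M * delta) (T g) (T0 g)) ->
  exists S, inverse_family H T S (2 * M).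
Proof.
move=> Tb TT0.
have K g : exists S, H g -> [/\ cancel (T g) S, cancel S (T g) & op_bound S (2 * M)].
  have [Hg|Hg] := pselect (H g); last by exists id.
  have [aT bT] := Tb g Hg; have [aT0 _] := T0b Hg; have [K1 K2 K3] := TS0 Hg.
  have [|S HS] := inverse_perturbation aT.1 bT M_gt0 K1 K2 aT0.1 K3 (TT0 g Hg).
    by have := deltaM; rewrite expr2; lra.
  by exists S.
by have [S HS] := choice K; exists S => g Hg; exact: HS.
Qed.

(** The displacement bound is the sum of the step lengths [2 * M * delta * 2^-1 ^+ j] over j < n. It
    stays below [4 * M * delta], within reach of [perturbed_inverse], so the inverse bound [2 * M]
    is the same at every stage. *)
Let stage n T := [/\ bounded_family act H T, continuous_family H T,
  forall g, H g -> op_near (4 * M * delta * (1 - 2^-1 ^+ n)) (T g) (T0 g) &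
  defect_le Gd sigma act H T (delta * 2^-1 ^+ n)].

Let stage_next n T : stage n T -> exists T',
  stage n.+1 T' /\ forall g, H g -> op_near (2 * M * delta * 2^-1 ^+ n) (T' g) (T g).
Proof.
move=> [Tb Tc Tn Td]; have h0 := half_exp_gt0 R n; set q := 2^-1 ^+ n in Tn Td h0 *.
have Md0 : 0 <= M * delta by rewrite mulr_ge0// ltW.
have q1 : q <= 1 by rewrite exprn_ile1// ?invr_ge0// invf_le1// ler1n.
have [|S TS] := @perturbed_inverse T Tb.
  by move=> g Hg; apply: op_near_le (Tn g Hg); nra.
have [chi [chic chi0 chiQ]] := Cc_cutoff R (hausdorff_arrows HG) (locally_compact_arrows HG) cQ.
have M2 : 0 < 2 * M by rewrite mulr_gt0.
have dq0 : 0 <= delta * q by rewrite mulr_ge0// ltW.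
pose T' := average Gd mu sigma act w chi T S.
have Tn' g : H g -> op_near (2 * M * delta * q) (T' g) (T g).
  move=> Hg; have := average_near HG Hsigma HE wc w_ge0 chic chi0 chiQ HQ M2 dq0 Tb Tc TS Td Hg.
  by apply: op_near_le; lra.
exists T'; split => //; split.
- exact: (average_bounded HG Hsigma HE wc w_ge0 chic chi0 chiQ HQ M2 dq0 Tb Tc TS Td).
- exact: (average_continuous HG Hsigma HE wc w_ge0 chic chi0 chiQ HQ M2 dq0 Tb Tc TS Td).
- move=> g Hg; apply: op_near_le (op_near_trans (Tn' g Hg) (Tn g Hg)).
  by rewrite exprS -/q; lra.
- move=> g h Hg Hh gh.
  have := average_defect HG Hsigma HE wc w_ge0 chic chi0 chiQ HQ M2 dq0 Tb Tc TS Td Hg Hh gh.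
  apply: op_near_le; rewrite expr2 exprS -/q.
  (* The new defect is 4 (2 M delta q)^2 = 16 M^2 delta^2 q^2, at most delta q / 2. The quadratic
     gain is only used to halve. *)
  have := deltaM; rewrite expr2 => dM.
  have h1 : (delta * q) * (q * (32 * (M * M) * delta)) <= delta * q.
    by rewrite ler_piMr// mulr_ile1// ?(ltW h0)// !mulr_ge0// ltW.
  lra.
Qed.

Theorem near_representation_rectification :
  exists T, [/\ bounded_family act H T, continuous_family H T,
    forall g, H g -> op_near (4 * M * delta) (T g) (T0 g),
    exists S, inverse_family H T S (2 * M) &
    forall g h, H g -> H h -> src Gd g = tgt Gd h ->
      T g \o T h =1 act (sigma g h) \o T (gmul Gd g h)].
Proof.
have st0 : stage 0 T0.
  split => //; last by rewrite expr0 mulr1.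
  by move=> g Hg e; rewrite !subrr !(mulr0, mul0r) normr0.
(* The hypothesis [stage] is placed under the existential so that a successor can be chosen for
   every pair and iterated by a plain fixpoint. *)
have step (nT : nat * (G -> E -> E)) : exists T', stage nT.1 nT.2 -> stage nT.1.+1 T' /\
    forall g, H g -> op_near (2 * M * delta * 2^-1 ^+ nT.1) (T' g) (nT.2 g).
  have [/stage_next[T' ?]|?] := pselect (stage nT.1 nT.2); first by exists T'.
  by exists nT.2.
have [next Hnext] := choice step.
pose T_ := fix T_ n := if n is n'.+1 then next (n', T_ n') else T0.
have stT n : stage n (T_ n) by elim: n => // n IH; exact: (Hnext (n, T_ n) IH).1.
have TT n g : H g -> op_near (2 * M * delta * 2^-1 ^+ n) (T_ n.+1 g) (T_ n g).
  exact: (Hnext (n, T_ n) (stT n)).2.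
have lim g : exists T, H g -> forall n, op_near (4 * M * delta * 2^-1 ^+ n) T (T_ n g).
  have [Hg|Hg] := pselect (H g); last by exists id.
  have lime e : exists l, forall n, `|l - T_ n g e| <= 2 * (2 * M * delta * `|e|) * 2^-1 ^+ n.
    by apply: geometric_limit => n; rewrite mulrAC; exact: TT.
  have [T HT] := choice lime; exists T => _ n e.
  by have := HT e n; rewrite -!mulrA; lra.
have [T HT] := choice lim.
have Tcvg g : H g -> op_cvg \oo (fun n => T_ n g) (T g).
  move=> Hg eps eps0.
  have small := half_exp_small (4 * M * delta) eps0.
  by apply: filterS small => n Hn; apply: op_near_sym; apply: op_near_le (HT g Hg n); exact: ltW.
have T0near g : H g -> op_near (4 * M * delta) (T g) (T0 g).
  by move=> Hg; have := HT g Hg 0; rewrite expr0 mulr1.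
have Tb : bounded_family act H T.
  move=> g Hg; split.
    apply: (@A_linear_limit _ _ _ act _ \oo _ (fun n => T_ n g)).
    - exact: act_linear HE.
    - by move=> a; exists `|a|; exact: (act_bound HE).
    - by move=> n; have [Tnb _ _ _] := stT n; exact: (Tnb g Hg).1.
    - exact: Tcvg.
  have [_ [c bT0]] := T0b Hg; exists (4 * M * delta + c); exact: op_near_bound (T0near g Hg) bT0.
exists T; split => //.
- move=> g Hg eps eps0; have e30 : 0 < eps / 3 by rewrite divr_gt0.
  have [n Hn] := filter_ex (half_exp_small (4 * M * delta) e30).
  have [_ Tc _ _] := stT n.
  have close k : H k -> op_near (eps / 3) (T k) (T_ n k).
    by move=> Hk; apply: op_near_le (HT k Hk n); exact: ltW.
  near=> k; have Hk : H k by near: k; exact: withinT.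
  have -> : eps = eps / 3 + (eps / 3 + eps / 3) by field.
  apply: op_near_trans (close k Hk) _; apply: op_near_trans (op_near_sym (close g Hg)).
  by near: k; exact: Tc.
- exact: perturbed_inverse.
move=> g h Hg Hh gh.
have Hgh := restriction_mul HG Hg Hh gh.
have [aTg [cg bg]] := Tb g Hg; have [aTh [ch bh]] := Tb h Hh; have [_ [cgh bgh]] := Tb _ Hgh.
apply: (@op_cvg_eq _ _ _ \oo _ (fun n => T_ n g \o T_ n h) (fun n => act (sigma g h) \o T_ n (gmul Gd g h))).
- exact: op_cvg_comp aTg.1 bg bh (Tcvg g Hg) (Tcvg h Hh).
- by apply: (op_cvg_comp (act_linear HE _) (act_bound HE _) bgh _ (Tcvg _ Hgh)); exact: op_cvg_cst.
- move=> eps eps0; have small := half_exp_small delta eps0.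
  apply: filterS small => n Hn; have [_ _ _ Tnd] := stT n.
  by apply: op_near_le (Tnd g h Hg Hh gh); exact: ltW.
Unshelve. all: by end_near. Qed.

End Rectification.

(** * The invariant mean of the isotropy group *)

(** Norm continuity on a compact set makes the integrand a uniform limit of finite sums with
    coefficients from a partition of unity. *)
Lemma operator_integral_exists (R : realType) (G : ptopologicalType) (E : completeNormedModType R)
    (Z : set G) (I : (G -> R) -> R) (q : G -> E -> E) (e : E) :
  hausdorff_space G -> locally_compact [set: G] -> compact Z ->
  positive_functional Z [set f | continuous f] I ->
  (forall k, Z k -> op_cvg (within Z (nbhs k)) q (q k)) ->
  exists b, is_integral Z [set f | continuous f] I (q^~ e) b.
Proof.
move=> hG lcG cZ DI qc; apply: is_integral_exists => // eps eps0.
pose N := (`|I (fun=> 1)| + 1) * (`|e| + 1).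
have N0 : 0 < N by rewrite mulr_gt0// ltr_wpDl.
pose d := eps / N; have d0 : 0 < d by rewrite divr_gt0.
pose V k := [set l | Z l -> op_near d (q l) (q k)].
have [l [psi [lZ psic psi1 _ psiV]]] := partition_of_unity R hG lcG cZ (U := V) (fun k Zk => qc k Zk d d0).
have c1 : continuous (fun _ : G => 1 : R) by exact: cst_continuous.
have [Dd Id] := pfZ DI (d * `|e|) c1.
exists (fun h => \sum_(i <- l) psi i h *: q i e), (\sum_(i <- l) I (psi i) *: q i e), (fun=> d * `|e| * 1); split => //.
- by apply: (@elementary_sum _ _ _ [set f | continuous f] I _ l psi (fun i => q i e)) => i; exact: (psic i).1.
- move=> h Zh; rewrite -[q h e]scale1r -(psi1 h Zh) scaler_suml -sumrB.
  apply: le_trans (ler_norm_sum _ _ _) _.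
  rewrite [leRHS]mulrC mulr_suml big_seq [leRHS]big_seq.
  apply: ler_sum => i il; rewrite -scalerBr normrZ ger0_norm ?(psic i).2//.
  have [->|pi] := eqVneq (psi i h) 0; first by rewrite !mul0r.
  by rewrite ler_wpM2l ?(psic i).2//; exact: (psiV i h il pi Zh).
- rewrite Id /d -[leRHS](divfK (lt0r_neq0 N0)) -!mulrA ler_wpM2l ?(ltW eps0)//.
  rewrite ler_wpM2l ?invr_ge0 ?(ltW N0)// /N mulrC.
  apply: (@le_trans _ _ (`|I (fun=> 1)| * `|e|)); first by rewrite ler_wpM2r// ler_norm.
  by apply: ler_pM => //; rewrite lerDl.
Qed.

Section InvariantMean.
Variables (R : realType) (X : topologicalType) (G : ptopologicalType).
Variables (Gd : groupoid X G) (mu : X -> {measure set (Borel G) -> \bar R}).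
Hypothesis HG : locally_compact_groupoid Gd mu.
Variables (x : X) (V0 : set X) (Q : set G) (chi : G -> R).
Hypotheses (nV0 : nbhs x V0) (cQ : compact Q) (VQ : restriction Gd V0 `<=` Q).
Hypotheses (chic : Cc chi) (chi_ge0 : forall h, 0 <= chi h) (chiQ : forall h, Q h -> chi h = 1).

Local Notation s := (src Gd).
Local Notation t := (tgt Gd).
Local Notation m := (gmul Gd).
Local Notation K := (isotropy Gd x).
Local Notation I := (fiber_integral Gd mu).

(** A filter of weights replaces a sequence, as [X] need not be first countable. Along an
    ultrafilter refining it every bounded functional of the weight converges. *)
Definition bump_filter : set_system (X -> R) :=
  filter_from (nbhs x) (fun V => [set w : X -> R | [/\ continuous w, forall y, 0 <= w y, w x = 1 &
    forall y, w y != 0 -> V y]]).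

Lemma bump_filter_proper : ProperFilter bump_filter.
Proof.
apply: filter_from_proper; last first.
  by move=> V nV; have [w [wc w0 wx wV]] := unit_bump HG nV; exists w.
apply: filter_from_filter; first by exists setT; exact: filterT.
move=> V W nV nW; exists (V `&` W); first exact: filterI.
by move=> w [wc w0 wx wVW]; split; split => // y /wVW[].
Qed.

Variable U : set_system (X -> R).
Hypotheses (UU : UltraFilter U) (bU : bump_filter `<=` U).

Lemma near_bump V : nbhs x V -> \forall w \near U,
  [/\ continuous (w : X -> R), forall y, 0 <= w y, w x = 1 & forall y, w y != 0 -> V y].
Proof. by move=> nV; apply: bU; exists V. Qed.

Lemma bump_mass_gt0 : \forall w \near U, 0 < mass Gd mu w chi x.
Proof.
apply: filterS (near_bump nV0) => w [wc w0 wx wV].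
apply: (@mass_gt0 _ _ _ _ _ HG w Q) => //=; last by rewrite wx oner_eq0.
by move=> g [sg tg]; apply: VQ; split; exact: wV.
Qed.

Definition weighted w (f : G -> R) h := chi h * w (s h) * f h.

Definition local_mean (w : X -> R) f := (mass Gd mu w chi x)^-1 * I x (weighted w f).

(** Continuity is asked along the fibre and at isotropy arrows only, because that is what survives
    translation by [m k]; integrability is asked for all weights close to the limit. *)
Definition mean_integrable : set (G -> R) := [set f |
  (\forall w \near U, fiber_integrable Gd mu x (weighted w f)) /\
  (forall k, K k -> f h @[h --> within (fiber Gd x) (nbhs k)] --> f k)].

Definition mean f := lim (local_mean w f @[w --> U]).

Lemma weighted_lin w r f g : weighted w (fun h => r * f h + g h) =
  fun h => r * weighted w f h + weighted w g h.
Proof. by apply/funext => h; rewrite /weighted; ring. Qed.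

Lemma compact_isotropy : compact K.
Proof.
have -> : K = Q `&` (s @^-1` [set x] `&` t @^-1` [set x]).
  apply/seteqP; split => [g [sg tg]|g [_ []]//]; split => //.
  by apply: VQ; split; rewrite ?sg ?tg; exact: nbhs_singleton.
apply: compact_closedI => //; apply: closedI; apply: closed_comp; try exact: (closed_unit1 HG).
- by move=> g _; exact: (src_continuous HG).
- by move=> g _; exact: (tgt_continuous HG).
Qed.

Lemma mean_integrable_lin r f g : mean_integrable f -> mean_integrable g ->
  mean_integrable (fun h => r * f h + g h).
Proof.
move=> [fi fc] [gi gc]; split; last first.
  by move=> k Kk; apply: cvgD; [apply: cvgM; [exact: cvg_cst|exact: fc]|exact: gc].
apply: filterS (filterI fi gi) => w [fw gw]; rewrite weighted_lin.
by have [_ H _ _] := fiber_positive_functional HG x; exact: H.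
Qed.

Lemma local_mean_lin w r f g : fiber_integrable Gd mu x (weighted w f) ->
  fiber_integrable Gd mu x (weighted w g) ->
  local_mean w (fun h => r * f h + g h) = r * local_mean w f + local_mean w g.
Proof.
move=> fw gw; rewrite /local_mean weighted_lin.
have [_ _ -> // _] := fiber_positive_functional HG x.
by rewrite mulrDr mulrCA.
Qed.

(** The reason why the mean lives on [K] although the Haar measure lives on the whole fibre: [f] is
    below C + eps on a fibre neighbourhood of the compact set [K], and weights concentrated near [x]
    see only that neighbourhood. *)
Lemma local_mean_le f C eps : mean_integrable f -> (forall k, K k -> f k <= C) -> 0 < eps ->
  \forall w \near U, local_mean w f <= C + eps.
Proof.
move=> [fi fc] fC eps0.
have [k l Kk Kl|W nW HW] := @near_isotropy _ _ _ _ _ HG x Q V0 (fun g _ => t g = x -> f g <= C + eps) nV0 cQ VQ.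
  have fk : f k < C + eps by apply: le_lt_trans (fC k Kk) _; rewrite ltrDl.
  have near_k : \forall h \near nbhs k, t h = x -> f h <= C + eps.
    exact: (cvgr_le _ (fc k Kk) _ fk).
  exists ([set h | t h = x -> f h <= C + eps], setT) => /=.
    by split => //; exact: filterT.
  by move=> [g h] [].
near=> w.
have wb : [/\ continuous w, forall y, 0 <= w y, w x = 1 & forall y, w y != 0 -> W y] by near: w; exact: near_bump.
have fw : fiber_integrable Gd mu x (weighted w f) by near: w.
have mw : 0 < mass Gd mu w chi x by near: w; exact: bump_mass_gt0.
have [wc w0 wx wW] := wb.
have cw : fiber_integrable Gd mu x (fun h => chi h * w (s h)).
  by apply: Cc_fiber_integrable => //; exact: (Cc_weight HG).
have DI := fiber_positive_functional HG x.
have [Dc Ic] := pfZ DI (C + eps) cw.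
rewrite /local_mean ler_pdivrMl// mulrC -Ic.
apply: (pf_le DI) => // h th; rewrite /weighted mulrC.
have [->|wh] := eqVneq (w (s h)) 0; first by rewrite !mulr0.
rewrite ler_wpM2r ?mulr_ge0//.
have rh : restriction Gd W h by split; [exact: wW|rewrite (th : t h = x); exact: nbhs_singleton].
exact: (HW h h rh rh th).
Unshelve. all: by end_near. Qed.

Lemma mean_integrable0 : mean_integrable (fun=> 0).
Proof.
split; last by move=> k Kk; exact: cvg_cst.
apply: filterE => w; rewrite (_ : weighted w _ = fun=> 0).
  by have [] := fiber_positive_functional HG x.
by apply/funext => h; rewrite /weighted mulr0.
Qed.

Lemma local_mean0 w : local_mean w (fun=> 0) = 0.
Proof.
rewrite /local_mean (_ : weighted w _ = fun=> 0); last by apply/funext => h; rewrite /weighted mulr0.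
by rewrite (pf0 (fiber_positive_functional HG x)) mulr0.
Qed.

Lemma ultrafilter_cvg_bounded (f : (X -> R) -> R) (C : R) :
  (\forall w \near U, `|f w| <= C) -> exists l : R, f w @[w --> U] --> l.
Proof.
move=> fC; have cC : compact `[-C, C]%classic by exact: segment_compact.
have UfC : (f @ U) `[-C, C]%classic.
  by apply: filterS fC => w; rewrite /= in_itv /= ler_norml.
have [l [_ Cl]] := cC _ _ UfC.
exists l => B nB; have [//|UB] := in_ultra_setVsetC (f @^-1` B) UU.
by have [r [/= nBr Br]] := Cl (~` B) B UB nB.
Qed.

Lemma mean_cvg f : mean_integrable f -> local_mean w f @[w --> U] --> mean f.
Proof.
move=> fD; have [fi fc] := fD.
have [C HC] : exists C, forall k, K k -> `|f k| <= C.
  have : bounded_set (f @` K).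
    apply: compact_bounded; apply: continuous_compact; last exact: compact_isotropy.
    apply/subspace_continuousP => k Kk B nB.
    have H : \forall h \near nbhs k, fiber Gd x h -> B (f h) by exact: (fc k Kk).
    by apply: filterS H => h Hh [_ th]; exact: Hh.
  move=> [N [_ /(_ (N + 1))]]; rewrite ltrDl ltr01 => /(_ isT) H.
  by exists (N + 1) => k Kk; apply: H; exists k.
(* The lower bound is the upper bound for the negative of [f], written in the shape of
   [mean_integrable_lin]. *)
have nfD : mean_integrable (fun h => -1 * f h + 0) by apply: mean_integrable_lin => //; exact: mean_integrable0.
have up : \forall w \near U, local_mean w f <= C + 1.
  by apply: local_mean_le => // k Kk; apply: le_trans (ler_norm _) (HC k Kk).
have down : \forall w \near U, local_mean w (fun h => -1 * f h + 0) <= C + 1.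
  by apply: local_mean_le => // k Kk; rewrite mulN1r addr0; apply: le_trans (ler_norm _) _; rewrite normrN HC.
have [|l fl] := @ultrafilter_cvg_bounded (local_mean^~ f) (C + 1).
  near=> w; rewrite ler_norml; apply/andP; split; last by near: w.
  have fw : fiber_integrable Gd mu x (weighted w f) by near: w.
  have zw : fiber_integrable Gd mu x (weighted w (fun=> 0)) by near: w; case: mean_integrable0.
  have : local_mean w (fun h => -1 * f h + 0) <= C + 1 by near: w.
  by rewrite local_mean_lin// local_mean0 mulN1r addr0 lerNl.
by rewrite /mean (cvg_lim (@Rhausdorff R) fl).
Unshelve. all: by end_near. Qed.

Lemma mean_positive_functional : positive_functional K mean_integrable mean.
Proof.
have lin r f g : mean_integrable f -> mean_integrable g ->
    mean (fun h => r * f h + g h) = r * mean f + mean g.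
  move=> fD gD; have lD := mean_integrable_lin r fD gD.
  apply: (@cvg_unique _ (@Rhausdorff R) _ _ _ _ (mean_cvg lD)).
  have lim : r * local_mean w f + local_mean w g @[w --> U] --> r * mean f + mean g.
    by apply: cvgD; [apply: cvgM; [exact: cvg_cst|exact: mean_cvg]|exact: mean_cvg].
  apply: cvg_trans lim; apply: near_eq_cvg.
  by apply: filterS (filterI fD.1 gD.1) => w [fw gw]; rewrite local_mean_lin.
split => //; first exact: mean_integrable0; first by move=> *; exact: mean_integrable_lin.
move=> f g fD gD fg.
have hD := mean_integrable_lin (-1) gD fD.
suff : -1 * mean g + mean f <= 0 by lra.
rewrite -lin//; apply/ler_addgt0Pr => eps eps0.
apply: (cvgr_to_le (mean_cvg hD)); apply: local_mean_le => // k Kk.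
by have := fg k Kk; lra.
Qed.

Lemma continuous_weighted_Cc w f : continuous w -> continuous f -> Cc (weighted w f).
Proof.
move=> wc fc.
rewrite (_ : weighted w f = fun h => chi h * (w (s h) * f h)); last by apply/funext => h; rewrite mulrA.
apply: CcM => //; apply: continuousM_pt => // h.
by apply: continuous_comp; [exact: (src_continuous HG)|exact: wc].
Qed.

Lemma continuous_mean_integrable f : continuous f -> mean_integrable f.
Proof.
move=> fc; split; last by move=> k _; apply: cvg_within_filter; exact: fc.
apply: filterS (near_bump nV0) => w [wc _ _ _].
by apply: Cc_fiber_integrable => //; exact: continuous_weighted_Cc.
Qed.

Lemma mean1 : mean (fun=> 1) = 1.
Proof.
apply: cvg_lim; first exact: Rhausdorff.
have c1 : (1 : R) @[w --> U] --> (1 : R) by exact: cvg_cst.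
apply: cvg_trans c1; apply: near_eq_cvg; apply: filterS bump_mass_gt0 => w mw.
rewrite /local_mean /mass (_ : weighted w _ = fun h => chi h * w (s h)).
  by rewrite mulVf// gt_eqF.
by apply/funext => h; rewrite /weighted mulr1.
Qed.

(** Both ends of [k] are [x], so translation preserves the measure over [x]; it keeps sources, hence
    the weight; and both [chi] factors are 1 where a weight supported in [V0] is nonzero. *)
Lemma mean_translate k f : K k -> continuous f ->
  mean_integrable (f \o m k) /\ mean (f \o m k) = mean f.
Proof.
move=> [sk tk] fc; have fD := continuous_mean_integrable fc.
have eqw : \forall w \near U, Cc (weighted w f) /\
    (forall h, fiber Gd x h -> weighted w (f \o m k) h = (weighted w f \o m k) h).
  apply: filterS (near_bump nV0) => w [wc w0 wx wV]; split; first exact: continuous_weighted_Cc.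
  move=> h th; have kh : s k = t h by rewrite sk th.
  rewrite /weighted /= (src_mul HG)//.
  have [->|wh] := eqVneq (w (s h)) 0; first by rewrite !mulr0 !mul0r.
  have V0x := nbhs_singleton nV0.
  rewrite !chiQ//; apply: VQ; split; rewrite ?(src_mul HG) ?(tgt_mul HG) ?tk//; try exact: wV.
  by rewrite (th : t h = x).
have intw : \forall w \near U, fiber_integrable Gd mu x (weighted w (f \o m k)) /\
    I x (weighted w (f \o m k)) = I x (weighted w f).
  apply: filterS eqw => w [cw ew]; have := fiber_integral_translate HG k cw.
  rewrite sk tk => -[ti tI]; split.
    apply: eq_integrable ti; first exact: (measurable_fiber HG).
    by move=> h; rewrite inE => th /=; rewrite ew.
  rewrite -tI /fiber_integral; apply: eq_Rintegral => h; rewrite inE => th.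
  by rewrite ew.
have kD : mean_integrable (f \o m k).
  split; first by apply: filterS intw => w [].
  move=> l [sl tl]; have /subspace_continuousP mc := @gmul_continuous_within _ _ _ _ _ HG k.
  have kl : (t @^-1` [set s k]) l by rewrite /= tl sk.
  have mkl := mc l kl; rewrite sk in mkl.
  exact: (cvg_comp _ _ mkl (fc _)).
split => //; apply: (@cvg_unique _ (@Rhausdorff R) _ _ _ _ (mean_cvg kD)).
have := mean_cvg fD; apply: cvg_trans; apply: near_eq_cvg.
by apply: filterS intw => w [_ Iw]; rewrite /local_mean Iw.
Qed.


Lemma continuous_positive_functional : positive_functional K [set f | continuous f] mean.
Proof.
have [_ _ ml mle] := mean_positive_functional.
split => [|r f g fc gc|r f g fc gc|f g fc gc].
- exact: cst_continuous.
- by move=> h; apply: cvgD; [apply: cvgM; [exact: cvg_cst|exact: fc]|exact: gc].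
- by apply: ml; exact: continuous_mean_integrable.
- by apply: mle; exact: continuous_mean_integrable.
Qed.

Variables (A : completeNormedModType R) (amul : A -> A -> A) (aone : A).
Variables (sigma : G -> G -> A) (E : completeNormedModType R) (act : A -> E -> E).
Hypothesis (HE : banach_module amul aone act).

(** [P] is the mean of q(l) = S(l) T(l)^-1. The multiplier cancels in q(kl) T(k) = S(k) q(l), so
    invariance of the mean gives P T(k) = S(k) P. Since every q(l) lies within c M <= 1/2 of the
    identity, so does [P], and [P] is invertible. *)
Lemma intertwiner_exists (S T T' : G -> E -> E) (M c : R) :
  bounded_family act K S -> continuous_family K S ->
  bounded_family act K T -> continuous_family K T -> inverse_family K T T' M -> 0 < M ->
  (forall k, K k -> op_near c (S k) (T k)) -> 0 <= c -> c * M <= 2^-1 ->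
  (forall k l, K k -> K l -> S k \o S l =1 act (sigma k l) \o S (m k l)) ->
  (forall k l, K k -> K l -> T k \o T l =1 act (sigma k l) \o T (m k l)) ->
  exists P P', [/\ A_linear act P, exists d, op_bound P d, exists d, op_bound P' d,
    cancel P P' /\ cancel P' P & forall k, K k -> S k \o P =1 P \o T k].
Proof.
move=> Sb Sc Tb Tc TT' M0 ST c0 cM Sm Tm.
have hG := hausdorff_arrows HG; have lcG := locally_compact_arrows HG.
pose q k := S k \o T' k.
have T'c k : K k -> op_cvg (within K (nbhs k)) T' (T' k).
  move=> Kk; have [K1 K2 bT'] := TT' k Kk.
  apply: (@op_cvg_inv _ _ _ _ _ T _ (T k) _ M) => //; last exact: Tc.
  apply: (@filterS _ _ _ K); last exact: withinT.
  by move=> l Kl; have [L1 L2 bL] := TT' l Kl; split => //; exact: (Tb l Kl).1.1.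
have qc k : K k -> op_cvg (within K (nbhs k)) q (q k).
  move=> Kk; have [K1 K2 bT'] := TT' k Kk; have [[lS _] [d bS]] := Sb k Kk.
  exact: op_cvg_comp lS bS bT' (Sc k Kk) (T'c k Kk).
have ql k : K k -> A_linear act (q k).
  move=> Kk; have [K1 K2 bT'] := TT' k Kk.
  by apply: A_linear_comp; [exact: (Sb k Kk).1|exact: A_linear_inv (Tb k Kk).1 K1 K2].
have qid k : K k -> op_near (c * M) (q k) id.
  move=> Kk e; have [K1 K2 bT'] := TT' k Kk.
  rewrite -{2}(K2 e); apply: le_trans (ST k Kk _) _.
  by rewrite -mulrA ler_wpM2l.
have DC := continuous_positive_functional; have DI := mean_positive_functional.
have [P HP] := choice (fun e => operator_integral_exists e hG lcG compact_isotropy DC qc).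
have c1 : continuous (fun _ : G => 1 : R) by exact: cst_continuous.
have aP : A_linear act P.
  split; first split.
  - move=> y z; apply: (is_integral_unique DC (HP (y + z))).
    apply: eq_is_integral (is_integralD DC (HP y) (HP z)) => k Kk.
    by rewrite (ql k Kk).1.1.
  - move=> r y; apply: (is_integral_unique DC (HP (r *: y))).
    have := is_integral_lin DC (linear_map_scale E r).1 (linear_map_scale E r).2 (op_bound_scale r) (HP y).
    by apply: eq_is_integral => k Kk /=; rewrite (ql k Kk).1.2.
  - move=> a y; apply: (is_integral_unique DC (HP (act a y))).
    have := is_integral_lin DC (act_linear HE a).1 (act_linear HE a).2 (act_bound HE a) (HP y).
    by apply: eq_is_integral => k Kk /=; rewrite (ql k Kk).2.
have Pid : op_near (c * M) P id.
  move=> e; have := is_integralB DC (HP e) (is_integral_scale DC e c1).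
  rewrite mean1 scale1r => Pe.
  have [Dd Id] := pfZ DC (c * M * `|e|) c1.
  rewrite -[leRHS]mulr1 -[X in _ <= _ * X]mean1 -Id.
  by apply: (is_integral_norm DC Pe Dd) => k Kk; rewrite ?scale1r mulr1; exact: qid.
have bid : op_bound (@id E) 1 by move=> e; rewrite mul1r.
have lid : linear_map (@id E) by split.
have Pb := op_near_bound Pid bid.
have [|P' [PP' P'P bP']] := @inverse_perturbation _ E P id id 1 (c * M) aP.1 (ex_intro _ _ Pb) ltr01
    (fun=> erefl) (fun=> erefl) lid bid Pid; first by rewrite mulr1.
exists P, P'; split => //; first by eexists; exact: Pb.
  by eexists; exact: bP'.
move=> k Kk e /=; have [sk tk] := Kk.
have [aS [d bS]] := Sb k Kk.
(* The translated integrand requires the class [mean_integrable], so both sides are compared there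
   and not among continuous functions. *)
have shift : is_integral K mean_integrable mean ((q^~ (T k e)) \o m k) (P (T k e)).
  apply: (is_integral_comp (theta := m k) (Z' := K) (D' := mean_integrable) (I' := mean)) (HP _).
    by move=> f fc; exact: mean_translate.
  move=> l [sl tl]; have kl : s k = t l by rewrite sk tl.
  by split; rewrite ?(src_mul HG)// (tgt_mul HG).
have left : is_integral K mean_integrable mean (fun l => S k (q l e)) (S k (P e)).
  have := is_integral_lin DC aS.1.1 aS.1.2 bS (HP e).
  apply: (is_integral_comp (theta := id) (Z' := K) (D' := mean_integrable) (I' := mean)) => // f fc.
  by split => //; exact: continuous_mean_integrable.
apply: (is_integral_unique DI left); apply: eq_is_integral shift => l Kl /=.
have [sl tl] := Kl; have kl : s k = t l by rewrite sk tl.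
have Kkl : K (m k l) by split; rewrite ?(src_mul HG)// (tgt_mul HG).
have [K1 K2 _] := TT' l Kl; have [L1 L2 _] := TT' _ Kkl.
have aT' := A_linear_inv (Tb _ Kkl).1 L1 L2.
rewrite /q /= -{1}(K2 e); have := Tm k l Kk Kl (T' l e); rewrite /= => ->.
rewrite aT'.2 L1 (Sb _ Kkl).1.2; by have := Sm k l Kk Kl (T' l e); rewrite /= => ->.
Qed.

End InvariantMean.

(** * Extending the representation *)

Section InitialNearRepresentation.
Variables (R : realType) (X : topologicalType) (G : ptopologicalType).
Variables (Gd : groupoid X G) (mu : X -> {measure set (Borel G) -> \bar R}).
Hypothesis HG : locally_compact_groupoid Gd mu.
Variables (A : completeNormedModType R) (amul : A -> A -> A) (aone : A).
Variables (sigma : G -> G -> A) (E : completeNormedModType R) (act : A -> E -> E).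
Hypotheses (Hsigma : multiplier Gd amul aone sigma) (HE : banach_module amul aone act).
Local Notation s := (src Gd).
Local Notation t := (tgt Gd).
Local Notation m := (gmul Gd).

(** Compactness is applied along the filter at infinity: since [P] is monotone in [c], a local bound
    holds for all large [c] on a neighbourhood. *)
Lemma compact_uniform_bound (Y : topologicalType) (Z : set Y) (P : R -> Y -> Prop) :
  compact Z -> (forall c d q, c <= d -> P c q -> P d q) ->
  (forall q, Z q -> exists c, \forall q' \near q, Z q' -> P c q') ->
  exists2 c, 1 <= c & forall q, Z q -> P c q.
Proof.
move=> /compact_near_coveringP cZ Pmono H.
have near_c : \forall c \near +oo%R, forall q, Z q -> Z q -> P c q.
  apply: (cZ _ _ (fun c q => Z q -> P c q)) => q Zq.
  have [c Hc] := H q Zq.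
  exists ([set q' | Z q' -> P c q'], [set d | c <= d]) => /=.
    by split => //; exact: nbhs_pinfty_ge (num_real c).
  by move=> [q' d] /= [Pc cd] Zq'; apply: Pmono cd (Pc Zq').
have [c [c1 Pc]] := filter_ex (filterI (nbhs_pinfty_ge (num_real (1 : R))) near_c).
by exists c => // q Zq; exact: Pc.
Qed.

Lemma bounded_A_linearP T : bounded_A_linear act T <-> A_linear act T /\ exists c, op_bound T c.
Proof.
split => [[TD TZ Ta Tb]|[[[TD TZ] Ta] Tb]]; last by [].
by split => //; split.
Qed.

Variables (x : X) (V0 : set X) (Q : set G).
Hypotheses (nV0 : nbhs x V0) (cQ : compact Q) (VQ : restriction Gd V0 `<=` Q).
Local Notation K := (isotropy Gd x).
Variable S : G -> E -> E.
Hypothesis HS : unif_cont_sigma_rep Gd sigma act K S.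

Let cK : compact K := compact_isotropy HG nV0 cQ VQ.

Lemma sigma_rep_bounded : bounded_family act K S.
Proof. by case: HS => gl _ _ _ k Kk; have [bS _] := gl k Kk; exact/bounded_A_linearP. Qed.

Lemma sigma_rep_continuous : continuous_family K S.
Proof. by case: HS => _ Sc _ _ k Kk eps eps0; exact: Sc. Qed.

Lemma sigma_rep_mul k l : K k -> K l -> S k \o S l =1 act (sigma k l) \o S (m k l).
Proof.
case: HS => _ _ _ Sm Kk Kl e /=; rewrite Sm//.
by rewrite Kk.1 Kl.2.
Qed.

Lemma sigma_rep_bound : exists2 c, 1 <= c & forall k, K k -> op_bound (S k) c.
Proof.
apply: (@compact_uniform_bound _ K (fun c k => op_bound (S k) c) cK).
  by move=> c d k cd Sc e; apply: le_trans (Sc e) _; rewrite ler_wpM2r.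
move=> k Kk; have [_ [c bS]] := sigma_rep_bounded Kk.
exists (1 + c); have H : \forall l \near nbhs k, K l -> op_near 1 (S l) (S k).
  exact: (sigma_rep_continuous Kk ltr01).
by apply: filterS H => l Sl Kl; exact: op_near_bound (Sl Kl) bS.
Qed.

Lemma sigma_rep_inverse : exists M S', 1 <= M /\ inverse_family K S S' M.
Proof.
have [|k Kk|M M1 HM] := @compact_uniform_bound _ K
  (fun c k => exists S', [/\ cancel (S k) S', cancel S' (S k) & op_bound S' c]) cK.
- move=> c d k cd [S' [? ? Sc]]; exists S'; split => // e.
  by apply: le_trans (Sc e) _; rewrite ler_wpM2r.
- have [gl _ _ _] := HS; have [_ [S' [/bounded_A_linearP[aS' [c bS']] [SS' S'S]]]] := gl k Kk.
  have [d d0 bd] := op_bound_pos bS'.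
  have e0 : 0 < (2 * d)^-1 by rewrite invr_gt0 mulr_gt0.
  exists (2 * d); have H : \forall l \near nbhs k, K l -> op_near (2 * d)^-1 (S l) (S k).
    exact: (sigma_rep_continuous Kk e0).
  apply: filterS H => l Sl Kl; have [aSl bSl] := sigma_rep_bounded Kl.
  apply: (inverse_perturbation aSl.1 bSl d0 SS' S'S (sigma_rep_bounded Kk).1.1 bd (Sl Kl)).
  by rewrite invfM -mulrA mulVf ?mulr1// gt_eqF.
- have H k : exists S', K k -> [/\ cancel (S k) S', cancel S' (S k) & op_bound S' M].
    by have [/HM[S' ?]|?] := pselect (K k); [exists S'|exists id].
  by have [S' HS'] := choice H; exists M, S'; split => // k Kk; exact: HS'.
Qed.

Lemma sigma_bound : exists2 c, 1 <= c & forall k l, K k -> K l -> `|sigma k l| <= c.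
Proof.
have [|[k l] [Kk Kl]|c c1 Hc] := @compact_uniform_bound _ (K `*` K) (fun c p => `|sigma p.1 p.2| <= c) (compact_setX cK cK).
- by move=> c d p cd /le_trans; apply.
- have kl : s k = t l by rewrite Kk.1 Kl.2.
  have [/subspace_continuousP/(_ (k, l) kl) sc _ _ _] := Hsigma.
  have nc : `|sigma p.1 p.2| @[p --> within (composable Gd) (nbhs (k, l))] --> `|sigma k l|.
    exact: (cvg_norm sc).
  exists (`|sigma k l| + 1).
  have H : \forall p \near nbhs (k, l), composable Gd p -> `|sigma p.1 p.2| <= `|sigma k l| + 1.
    have lt1 : `|sigma k l| < `|sigma k l| + 1 by rewrite ltrDl.
    have H' : \forall p \near within (composable Gd) (nbhs (k, l)), `|sigma p.1 p.2| <= `|sigma k l| + 1.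
      exact: (cvgr_le _ nc _ lt1).
    exact: H'.
  apply: filterS H => -[k' l'] Hp [Kk' Kl']; apply: Hp.
  by rewrite /composable /= Kk'.1 Kl'.2.
- by exists c => // k l Kk Kl; exact: (Hc (k, l)).
Qed.

(* The extension need not agree with S on the isotropy group: conjugation with the
   intertwiner removes the error. *)
Lemma approximate_extension eps : 0 < eps -> exists T : G -> E -> E,
  [/\ forall g, A_linear act (T g) /\ exists c, op_bound (T g) c,
      forall g, op_cvg (nbhs g) T (T g) & forall k, K k -> op_near eps (T k) (S k)].
Proof.
move=> eps0.
pose U k := [set l | K l -> op_near eps (S l) (S k)].
have [l [psi [lK psic psi1 _ psiU]]] := partition_of_unity R (hausdorff_arrows HG) (locally_compact_arrows HG)
  cK (U := U) (fun k Kk => sigma_rep_continuous Kk eps0).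
pose B i e := if `[< K i >] then S i e else 0.
have aB i : A_linear act (B i) /\ exists c, op_bound (B i) c.
  rewrite /B; case: asboolP => [/sigma_rep_bounded//|_]; split; last first.
    by exists 0 => e; rewrite normr0 mul0r.
  split; first by split=> *; rewrite ?addr0 ?scaler0.
  by move=> a e; rewrite (linear_map0 (act_linear HE a)).
have Tc g : op_cvg (nbhs g) (fun h e => \sum_(i <- l) psi i h *: B i e) (fun e => \sum_(i <- l) psi i g *: B i e).
  by apply: op_cvg_sum => i; [exact: (aB i).2|exact: (psic i).1].
exists (fun g e => \sum_(i <- l) psi i g *: B i e); split => //.
- move=> g; split; last first.
    elim: (l) => [|i l' [c IH]]; first by exists 0 => e; rewrite big_nil normr0 mul0r.
    have [_ [d bB]] := aB i; exists (`|psi i g| * d + c) => e; rewrite big_cons mulrDl.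
    apply: le_trans (ler_normD _ _) _; rewrite lerD//.
    by rewrite normrZ -mulrA ler_wpM2l.
  split; first split.
  + move=> y z; rewrite -big_split; apply: eq_bigr => i _.
    by rewrite (aB i).1.1.1 scalerDr.
  + move=> r y; rewrite scaler_sumr; apply: eq_bigr => i _.
    by rewrite (aB i).1.1.2 !scalerA mulrC.
  + move=> a y; have lin := act_linear HE a.
    elim: (l) => [|i l' IH]; first by rewrite !big_nil linear_map0.
    by rewrite !big_cons lin.1 IH (aB i).1.2 lin.2.
- move=> k Kk e.
  rewrite -[S k e]scale1r -(psi1 k Kk) scaler_suml -sumrB.
  apply: le_trans (ler_norm_sum _ _ _) _.
  rewrite -[leRHS]mul1r -(psi1 k Kk) mulr_suml big_seq [leRHS]big_seq.
  apply: ler_sum => i il; rewrite -scalerBr normrZ ger0_norm ?(psic i).2//.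
  have [->|pi] := eqVneq (psi i k) 0; first by rewrite !mul0r.
  rewrite ler_wpM2l ?(psic i).2// distrC /B asboolT; last exact: lK.
  exact: (psiU i k il pi Kk).
Qed.

Lemma initial_near_representation : exists (M delta c : R) (W : set X) (T T' : G -> E -> E),
  [/\ nbhs x W, W `<=` V0,
   [/\ 1 <= M, 0 < delta, 32 * M ^+ 2 * delta <= 1, 0 <= c & (c + 4 * M * delta) * (2 * M) <= 2^-1],
   [/\ bounded_family act (restriction Gd W) T, continuous_family (restriction Gd W) T,
       inverse_family (restriction Gd W) T T' M & defect_le Gd sigma act (restriction Gd W) T delta] &
   forall k, K k -> op_near c (T k) (S k)].
Proof.
have [C C1 bS] := sigma_rep_bound.
have [M0 [S' [M01 SS']]] := sigma_rep_inverse.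
have [Cs Cs1 bsigma] := sigma_bound.
(* The factor 2 is the loss of [inverse_perturbation] in passing from [S] to nearby operators. *)
pose M := 2 * M0; have M2 : 2 <= M by rewrite /M; lra.
have Mpos : 0 < M by lra.
pose delta := (32 * M ^+ 2)^-1.
have Msq : 0 < 32 * M ^+ 2 by rewrite mulr_gt0// exprn_gt0.
have delta0 : 0 < delta by rewrite invr_gt0.
have dM : 32 * M ^+ 2 * delta = 1 by rewrite /delta divff// gt_eqF.
(* The defect at a pair of isotropy arrows is at most [eps * (2 * C + 1 + Cs)]; moving to a nearby
   pair costs two further halves of [eps]. *)
pose N := 2 * C + 2 + Cs; have N0 : 0 < N by rewrite /N; lra.
(* The bound 1 gives eps^2 <= eps. The second one gives inverses near [K], and 2 eps M <= 1/4, which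
   together with 8 M^2 delta = 1/4 makes the total 1/2 required by the intertwiner. The third one
   brings the defect below [delta]. *)
pose eps := Num.min 1 (Num.min (8 * M)^-1 (delta / N)).
have eps0 : 0 < eps by rewrite !lt_min ltr01 divr_gt0// invr_gt0 mulr_gt0.
have eps1 : eps <= 1 by rewrite ge_min lexx.
have epsM : eps * M <= 8^-1.
  have : eps <= (8 * M)^-1 by rewrite !ge_min lexx !orbT.
  by rewrite invfM => h; rewrite -(@ler_pM2r _ M^-1) ?invr_gt0// mulfK ?gt_eqF.
have epsN : eps * N <= delta.
  by rewrite -ler_pdivlMr// !ge_min lexx !orbT.
have [T [Tlin Tc TS]] := approximate_extension eps0.
pose good g := exists T', [/\ cancel (T g) T', cancel T' (T g) & op_bound T' M].
have [k l Kk Kl|W nW HW] := @near_isotropy _ _ _ _ _ HG x Q V0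
  (fun g h => good g /\ (s g = t h -> op_near delta (T g \o T h) (act (sigma g h) \o T (m g h)))) nV0 cQ VQ.
  have [S1 S2 bS'] := SS' k Kk.
  have kl : s k = t l by rewrite Kk.1 Kl.2.
  have near_good : \forall g \near nbhs k, good g.
    have H := Tc k eps eps0; apply: filterS H => g Tg.
    apply: (inverse_perturbation (Tlin g).1.1 (Tlin g).2 _ S1 S2 (sigma_rep_bounded Kk).1.1 bS' (op_near_trans Tg (TS k Kk))).
      by lra.
    by move: epsM; rewrite /M; lra.
  have bT k' : K k' -> op_bound (T k') (eps + C) by move=> Kk'; exact: op_near_bound (TS k' Kk') (bS k' Kk').
  have Kkl : K (m k l) by split; rewrite ?(src_mul HG) ?(tgt_mul HG)// (Kk.2, Kl.1).
  have at_kl : op_near (eps * (2 * C + 1 + Cs)) (T k \o T l) (act (sigma k l) \o T (m k l)).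
    have n1 : op_near ((eps + C) * eps) (T k \o T l) (T k \o S l).
      move=> e /=; rewrite -linear_mapB; last exact: (Tlin k).1.1.
      apply: le_trans (bT k Kk _) _; rewrite -mulrA ler_wpM2l//; [lra|exact: TS].
    have n2 : op_near (eps * C) (T k \o S l) (S k \o S l).
      move=> e /=; apply: le_trans (TS k Kk _) _.
      by rewrite -mulrA ler_wpM2l ?(ltW eps0)//; exact: bS.
    have n3 : op_near (Cs * eps) (S k \o S l) (act (sigma k l) \o T (m k l)).
      move=> e; rewrite (sigma_rep_mul Kk Kl) /= -linear_mapB; last exact: (act_linear HE).
      apply: le_trans (act_bound HE _ _) _; rewrite -mulrA.
      by apply: ler_pM => //; [exact: bsigma|rewrite distrC; exact: TS].
    apply: op_near_le (op_near_trans n1 (op_near_trans n2 n3)).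
    have : eps * eps <= eps by rewrite ler_piMl ?(ltW eps0).
    lra.
  set F := within (composable Gd) (nbhs (k, l)).
  have fst_cvg : p.1 @[p --> F] --> nbhs k by apply: cvg_within_filter; exact: cvg_fst.
  have snd_cvg : p.2 @[p --> F] --> nbhs l by apply: cvg_within_filter; exact: cvg_snd.
  have mul_cvg : m p.1 p.2 @[p --> F] --> nbhs (m k l).
    by move=> O nO; have H := near_gmul HG kl nO; apply: filterS H => p Op; exact: Op.
  have sigma_cvg : sigma p.1 p.2 @[p --> F] --> sigma k l.
    by have [/subspace_continuousP/(_ (k, l) kl) sc _ _ _] := Hsigma.
  have c1 : op_cvg F (fun p => T p.1 \o T p.2) (T k \o T l).
    apply: (op_cvg_comp (Tlin k).1.1 (bT k Kk) (bT l Kl)).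
      exact: op_cvg_reindex fst_cvg (Tc k).
    exact: op_cvg_reindex snd_cvg (Tc l).
  have c2 : op_cvg F (fun p => act (sigma p.1 p.2) \o T (m p.1 p.2)) (act (sigma k l) \o T (m k l)).
    apply: (op_cvg_comp (act_linear HE _) (act_bound HE _) (bT _ Kkl)).
      exact: (act_cvg HE).
    exact: op_cvg_reindex mul_cvg (Tc _).
  have e20 : 0 < eps / 2 by rewrite divr_gt0.
  have near1 : \forall p \near nbhs (k, l), composable Gd p ->
      op_near (eps / 2) (T p.1 \o T p.2) (T k \o T l) by exact: c1.
  have near2 : \forall p \near nbhs (k, l), composable Gd p ->
      op_near (eps / 2) (act (sigma p.1 p.2) \o T (m p.1 p.2)) (act (sigma k l) \o T (m k l)) by exact: c2.
  have near3 : \forall p \near nbhs (k, l), good p.1 by exact: cvg_fst near_good.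
  apply: filterS (filterI near3 (filterI near1 near2)) => -[g h] /= [gg [h1 h2]]; split => // gh.
  apply: op_near_le (op_near_trans (h1 gh) (op_near_trans at_kl (op_near_sym (h2 gh)))).
  by apply: le_trans epsN; rewrite /N; lra.
have Hgood g : exists T', restriction Gd W g -> [/\ cancel (T g) T', cancel T' (T g) & op_bound T' M].
  have [Wg|Wg] := pselect (restriction Gd W g); last by exists id.
  by have [[T' ?] _] := HW g g Wg Wg; exists T'.
have [T' HT'] := choice Hgood.
have sub g : restriction Gd (W `&` V0) g -> restriction Gd W g by move=> [[? _] [? _]].
exists M, delta, eps, (W `&` V0), T, T'; split => //.
- exact: filterI.
- split => //; [lra|by rewrite dM|exact: ltW|].
  have : 8 * M ^+ 2 * delta = 4^-1 by rewrite -[LHS]mulr1 -[8]/(8%:R); lra.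
  by rewrite expr2; lra.
- split.
  + by move=> g _; exact: Tlin.
  + by move=> g _ d d0; apply: cvg_within; exact: Tc.
  + by move=> g /sub Hg; exact: HT'.
  + by move=> g h /sub Hg /sub Hh gh; exact: (HW g h Hg Hh).2.
Qed.

End InitialNearRepresentation.

(** * The extension, by conjugation with the intertwiner *)

Theorem mainTheorem6
  (R : realType) (X : topologicalType) (G : ptopologicalType)
  (Gd : groupoid X G) (mu : X -> {measure set (Borel G) -> \bar R})
  (HG : locally_compact_groupoid Gd mu) (Hprop : proper_groupoid R Gd)
  (A : completeNormedModType R) (amul : A -> A -> A) (aone : A)
  (HA : banach_algebra amul aone)
  (sigma : G -> G -> A) (Hsigma : multiplier Gd amul aone sigma)
  (Hsigma_norm : forall g h : G, src Gd g = tgt Gd h ->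
      forall b : A, amul (sigma g h) b = aone -> amul b (sigma g h) = aone ->
      `|b| = `|sigma g h|^-1)
  (x : X)
  (E : completeNormedModType R) (act : A -> E -> E)
  (HE : banach_module amul aone act)
  (S : G -> E -> E)
  (HS : unif_cont_sigma_rep Gd sigma act (isotropy Gd x) S) :
  exists V : set X, [/\ open V, V x &
    exists Rep : G -> E -> E,
      unif_cont_sigma_rep Gd sigma act (restriction Gd V) Rep /\
      forall k : G, isotropy Gd x k -> Rep k = S k].
Proof.
have [V0 [Q [nV0 cQ VQ]]] := compact_isotropy_neighborhood HG x Hprop.
have [chi [chic chi0 chiQ]] := Cc_cutoff R (hausdorff_arrows HG) (locally_compact_arrows HG) cQ.
have [M [delta [c [W [T0 [T0' [nW WV0 [M1 delta0 dM c0 cM] [T0b T0c T0i T0d] T0S]]]]]]] :=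
  initial_near_representation HG Hsigma HE nV0 cQ VQ HS.
have Mpos : 0 < M by lra.
have [w [wc w0 wx wW]] := unit_bump HG nW.
pose V := [set y | w y != 0]; pose H := restriction Gd V.
have HW g : H g -> restriction Gd W g by move=> [? ?]; split; exact: wW.
have HQ : H `<=` Q by move=> g /HW[? ?]; apply: VQ; split; exact: WV0.
have oV : open V.
  rewrite (_ : V = w @^-1` (~` [set 0])); last by apply/seteqP; split => y /= /eqP.
  apply: open_comp; first by move=> y _; exact: wc.
  by apply: closed_openC; exact: closed_eq.
have Vx : V x by rewrite /V /= wx oner_eq0.
have KH k : isotropy Gd x k -> H k by move=> [sk tk]; split; rewrite ?sk ?tk.
have sub_cvg (B C : set G) (T : G -> E -> E) : B `<=` C -> continuous_family C T -> continuous_family B T.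
  move=> BC CT g Bg d d0; have h : \forall k \near nbhs g, C k -> op_near d (T k) (T g) by exact: (CT g (BC g Bg)).
  by apply: filterS h => k hk Bk; apply: hk; exact: BC.
have [T [Tb Tc TT0 [T' TT'] Tm]] : exists T, [/\ bounded_family act H T, continuous_family H T,
    forall g, H g -> op_near (4 * M * delta) (T g) (T0 g),
    exists S, inverse_family H T S (2 * M) &
    forall g h, H g -> H h -> src Gd g = tgt Gd h ->
      T g \o T h =1 act (sigma g h) \o T (gmul Gd g h)].
  apply: (near_representation_rectification HG Hsigma HE wc w0 cQ HQ (S0 := T0') Mpos (ltW delta0) dM).
  - by move=> g /HW; exact: T0b.
  - exact: sub_cvg HW T0c.
  - by move=> g /HW; exact: T0i.
  - by move=> g h /HW Hg /HW Hh; exact: T0d.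
(* This ultrafilter of weights is used for the mean on G(x) only; the weight [w] defining [V] stays
   fixed. *)
have [U [UU bU]] := ultraFilterLemma (bump_filter_proper HG x).
have M2 : 0 < 2 * M by lra.
have cd0 : 0 <= c + 4 * M * delta by rewrite addr_ge0// !mulr_ge0// ltW.
have ST k : isotropy Gd x k -> op_near (c + 4 * M * delta) (S k) (T k).
  move=> Kk; apply: op_near_trans (op_near_sym (T0S k Kk)) _.
  by apply: op_near_sym; apply: TT0; exact: KH.
have Kst k l : isotropy Gd x k -> isotropy Gd x l -> src Gd k = tgt Gd l by move=> [-> _] [_ ->].
have [P [P' [aP [dP bP] [dP' bP'] [PP' P'P] SP]]] :=
  intertwiner_exists HG nV0 cQ VQ chic chi0 chiQ UU bU HE
    (sigma_rep_bounded HS) (sigma_rep_continuous HS) (fun k Kk => Tb k (KH k Kk))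
    (sub_cvg _ _ _ KH Tc) (fun k Kk => TT' k (KH k Kk)) M2 ST cd0 cM
    (sigma_rep_mul HS) (fun k l Kk Kl => Tm k l (KH k Kk) (KH l Kl) (Kst k l Kk Kl)).
have aP' := A_linear_inv aP PP' P'P.
exists V; split => //; exists (fun g => P \o (T g \o P')); split; last first.
  by move=> k Kk; apply/funext => e /=; have := SP k Kk (P' e); rewrite /= P'P => ->.
have bound_comp B C : (exists b, op_bound B b) -> (exists c, op_bound C c) ->
    exists d, op_bound (B \o C) d.
  move=> [b /op_bound_pos[b' b'0 Bb]] [d Cd]; exists (b' * d).
  by apply: op_bound_comp => //; exact: ltW.
split.
- move=> g Hg; have [aT bT] := Tb g Hg; have [K1 K2 bT'] := TT' g Hg.
  split; first apply/bounded_A_linearP; first split.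
  + by apply: A_linear_comp => //; exact: A_linear_comp.
  + by apply: (bound_comp); [exists dP|apply: (bound_comp) => //; exists dP'].
  exists (P \o (T' g \o P')); split; first apply/bounded_A_linearP; first split.
  + by apply: A_linear_comp => //; apply: A_linear_comp => //; exact: A_linear_inv aT K1 K2.
  + by apply: (bound_comp); [exists dP|apply: (bound_comp); [exists (2 * M)|exists dP']].
  + by split=> e /=; rewrite PP' ?K1 ?K2 P'P.
- move=> g Hg eps eps0; have [aT [b bT]] := Tb g Hg.
  have [dP1 dP10 bP1] := op_bound_pos bP'; have [b1 b10 bT1] := op_bound_pos bT.
  have cst (B : E -> E) : op_cvg (within H (nbhs g)) (fun=> B) B by exact: op_cvg_cst.
  have TP : op_cvg (within H (nbhs g)) (fun k => T k \o P') (T g \o P').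
    exact: op_cvg_comp aT.1 bT1 bP1 (Tc g Hg) (cst P').
  have PTP : op_cvg (within H (nbhs g)) (fun k => P \o (T k \o P')) (P \o (T g \o P')).
    exact: op_cvg_comp aP.1 bP (op_bound_comp bT1 bP1 (ltW b10)) (cst P) TP.
  exact: PTP.
- move=> y [Vy _]; rewrite (src_unit HG) in Vy.
  have Hu : H (unit Gd y) := restriction_unit HG Vy.
  have [K1 _ _] := TT' _ Hu.
  have su : src Gd (unit Gd y) = tgt Gd (unit Gd y) by rewrite (src_unit HG) (tgt_unit HG).
  have uu : gmul Gd (unit Gd y) (unit Gd y) = unit Gd y.
    by have := gmulg1 HG (unit Gd y); rewrite (src_unit HG).
  have Tu e : T (unit Gd y) e = e.
    (* At a unit the multiplier is 1, so [T] is idempotent there; being injective, it is the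
       identity. *)
    apply: (can_inj K1); have := Tm _ _ Hu Hu su e; rewrite /= uu => ->.
    have [_ _ sigma1 _] := Hsigma.
    by rewrite sigma1//; [exact: (act1 HE)|left; exists y].
  by apply/funext => e /=; rewrite Tu P'P.
- move=> g h Hg Hh gh e /=; rewrite PP' -aP.2; congr (P _).
  by have := Tm g h Hg Hh gh (P' e); rewrite /= => ->.
Qed.
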